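(* Let $X$ be a Banach space. The following are equivalent: (1) $X$ has property (R), that is, every weakly precompact subset of $X$ is relatively super weakly compact; (2) every weakly compact subset of $X$ is super weakly compact.
   Context: For a free ultrafilter $\mathcal{U}$ on $\mathbb{N}$, the ultrapower $X^{\mathcal{U}}$ of a Banach space $X$ is the quotient of $\ell_\infty(X)$ (the bounded sequences in $X$ with the supremum norm) by the subspace $N_{\mathcal{U}} = \{(x_n)_{n\in\mathbb{N}} \in \ell_\infty(X) : \lim_{\mathcal{U}} x_n = 0\}$. For $A \subseteq X$, $A^{\mathcal{U}}$ denotes the subset of $X^{\mathcal{U}}$ consisting of those elements which have a representative $(x_n)_{n\in\mathbb{N}}$ with $x_n \in A$ for each $n \in \mathbb{N}$. A subset $A$ of a Banach space $X$ is relatively super weakly compact if $A^{\mathcal{U}}$ is relatively weakly compact in $X^{\mathcal{U}}$ for every free ultrafilter $\mathcal{U}$ on $\mathbb{N}$. It is super weakly compact if it is relatively super weakly compact and weakly closed. A sequence $(x_n)_{n\in\mathbb{N}}$ in $X$ is weakly Cauchy if for every $x^* \in X^*$ the scalar sequence $(x^*(x_n))_{n\in\mathbb{N}}$ is convergent. A subset $A$ of $X$ is weakly precompact if every sequence in $A$ has a weakly Cauchy subsequence. *)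

(* Defs.v *)
From HB Require Import structures.
From mathcomp Require Import all_boot all_order all_algebra.
From mathcomp Require Import generic_quotient ring_quotient.
From mathcomp Require Import all_classical all_reals all_analysis.
From mathcomp Require Import complex.

Set Implicit Arguments.
Unset Strict Implicit.
Unset Printing Implicit Defensive.

Import Order.TTheory GRing.Theory Num.Theory.
Import numFieldNormedType.Exports.

Local Open Scope classical_set_scope.
Local Open Scope ring_scope.
Local Open Scope quotient_scope.

(** Banach spaces are taken over the real or the complex numbers. The notions
below are defined over any [K : numFieldType]; the norm of the ultrapower
moreover needs suprema of bounded sets of real elements of [K], which [K = R]
and [K = R[i]] provide for every [R : realType]. *)
Class real_complete (K : numFieldType) : Prop :=
  real_supremums : forall A : set K, A `<=` [set` Num.real] -> has_sup A ->
    supremums A !=set0.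

#[global] Instance realType_real_complete (R : realType) : real_complete R.
Proof.
move=> A _ hA; exists (sup A); split; last by move=> y /ge_sup; apply; case: hA.
by move=> x Ax; apply: sup_upper_bound.
Qed.

#[global] Instance complex_real_complete (R : realType) :
  real_complete (complex R).
Proof.
move=> A Areal [[a Aa] [b ub_b]].
pose B := [set complex.Re x | x in A].
have AE x : A x -> x = real_complex R (complex.Re x) by move=> /Areal/RRe_real ->.
have hB : has_sup B.
  split; first by exists (complex.Re a), a.
  by exists (complex.Re b) => _ [x Ax <-]; move: (ub_b _ Ax); rewrite lecE => /andP[].
exists (real_complex R (sup B)); split=> [x Ax|y uby].
  by rewrite (AE x Ax) lecR; apply: sup_upper_bound => //; exists x.
have /= := uby _ Aa; rewrite (AE a Aa) lecE /= => /andP[Imy _].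
rewrite lecE /= Imy /=; apply: ge_sup; first by exists (complex.Re a), a.
by move=> _ [x Ax <-]; move: (uby _ Ax); rewrite lecE => /andP[].
Qed.

Section weak_topology.
Variables (K : numFieldType) (X : normedModType K).

Definition dual := {f : {scalar X} | continuous (f : X -> K)}.

Definition weak : Type :=
  sup_topology (fun f : dual =>
    Topological.class (initial_topology (sval f : X -> K))).

HB.instance Definition _ := Topological.copy weak
  (sup_topology (fun f : dual =>
    Topological.class (initial_topology (sval f : X -> K)))).

Implicit Type A : set X.

Definition weakly_closed A := closed (A : set weak).

Definition weakly_compact A := compact (A : set weak).

Definition relatively_weakly_compact A := compact (closure (A : set weak)).

Definition weakly_cauchy (x : nat -> X) :=
  forall f : dual, cvg (sval f (x n) @[n --> \oo]).

Definition weakly_precompact A :=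
  forall x : nat -> X, (forall n, A (x n)) ->
    exists2 phi : nat -> nat, {homo phi : m n / (m < n)%N}
                            & weakly_cauchy (x \o phi).

End weak_topology.

Section bounded_sequences.
Variables (K : numFieldType) (X : normedModType K).

Definition bounded_seq : {pred nat -> X} := fun x => `[< bounded_fun x >].

Lemma bounded_seqP (x : nat -> X) :
  reflect (exists2 M, 0 <= M & forall n, `|x n| <= M) (x \in bounded_seq).
Proof.
apply: (iffP (asboolP _)) => [[M [Mreal xM]]|[M M0 xM]].
  have M1 : M < `|M| + 1 by rewrite (le_lt_trans (real_ler_norm Mreal))// ltrDl.
  by exists (`|M| + 1) => [|n]; [rewrite addr_ge0|exact: (xM _ M1)].
exists M; split; first exact: ger0_real.
by move=> N MN n _ /=; rewrite (le_trans (xM n))// ltW.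
Qed.

Lemma bounded_seq_submod : submod_closed bounded_seq.
Proof.
split; first by apply/bounded_seqP; exists 0 => // n; rewrite normr0.
move=> a x y /bounded_seqP[M M0 xM] /bounded_seqP[N N0 yN].
apply/bounded_seqP; exists (`|a| * M + N) => [|n].
  by rewrite addr_ge0 ?mulr_ge0.
rewrite (le_trans (ler_normD _ _))// lerD// normrZ.
by rewrite ler_wpM2l.
Qed.

HB.instance Definition _ :=
  GRing.isSubmodClosed.Build K (nat -> X) bounded_seq bounded_seq_submod.

End bounded_sequences.

(** [rcK] does not restrict the sequences: it is a parameter of the type because
the norm axioms of the sup norm depend on it. *)
Record linf (K : numFieldType) (rcK : real_complete K) (X : normedModType K) :=
  Linf { linf_val :> nat -> X ; linf_bounded : linf_val \in @bounded_seq K X }.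

Section linf_normed.
Variables (K : numFieldType) (rcK : real_complete K) (X : normedModType K).
Local Notation L := (linf rcK X).

HB.instance Definition _ := [isSub for @linf_val K rcK X].
HB.instance Definition _ := [Choice of L by <:].
HB.instance Definition _ := [SubChoice_isSubLmodule of L by <:].

Definition linf_norm (x : L) : K := supremum 0 (range (fun n => `|x n|)).

Lemma linf_norm_supremums (x : L) :
  supremums (range (fun n => `|x n|)) (linf_norm x).
Proof.
have [s sup_s] : supremums (range (fun n => `|x n|)) !=set0.
  apply: rcK => [_ [n _ <-] /=|]; first exact: normr_real.
  split; first by exists `|x 0%N|, 0%N.
  have /bounded_seqP[M M0 xM] := linf_bounded x.
  by exists M => _ [n _ <-].
rewrite /linf_norm /supremum; case: ifPn => [/eqP xx0|_]; last first.
  by apply: xgetPex; exists s.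
have : range (fun n => `|x n|) `|x 0%N| by exists 0%N.
by rewrite xx0.
Qed.

Lemma linf_norm_ge (x : L) n : `|x n| <= linf_norm x.
Proof. by have [ub _] := linf_norm_supremums x; apply: ub; exists n. Qed.

Lemma linf_norm_le (x : L) t : (forall n, `|x n| <= t) -> linf_norm x <= t.
Proof.
by move=> xt; have [_ lb] := linf_norm_supremums x; apply: lb => _ [n _ <-].
Qed.

Lemma linf_norm_ge0 (x : L) : 0 <= linf_norm x.
Proof. exact: le_trans (normr_ge0 (x 0%N)) (linf_norm_ge x 0%N). Qed.

Let linf_normD (x y : L) : linf_norm (x + y) <= linf_norm x + linf_norm y.
Proof.
apply: linf_norm_le => n.
by rewrite (le_trans (ler_normD _ _))// lerD// linf_norm_ge.
Qed.

Let linf_normZ_le (a : K) (x : L) : linf_norm (a *: x) <= `|a| * linf_norm x.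
Proof.
by apply: linf_norm_le => n; rewrite normrZ ler_wpM2l// linf_norm_ge.
Qed.

Let linf_normZ (a : K) (x : L) : linf_norm (a *: x) = `|a| * linf_norm x.
Proof.
apply/eqP; rewrite eq_le linf_normZ_le /=.
have [->|a0] := eqVneq a 0; first by rewrite normr0 mul0r linf_norm_ge0.
rewrite -ler_pdivlMl ?normr_gt0// -normfV.
by rewrite -{1}(scalerK a0 x) linf_normZ_le.
Qed.

Let linf_norm0_eq0 (x : L) : linf_norm x = 0 -> x = 0.
Proof.
move=> x0; apply/val_inj/funext => n /=; apply/eqP; rewrite -normr_le0 -x0.
exact: linf_norm_ge.
Qed.

HB.instance Definition _ :=
  Lmodule_isNormed.Build K L linf_normD linf_normZ linf_norm0_eq0.

End linf_normed.

Section ultrapower.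
Variables (K : numFieldType) (rcK : real_complete K) (X : normedModType K).
Variables (U : set_system nat) (FU : Filter U).
Local Notation L := (linf rcK X).

(** The space $N_U$. Its definition does not use the proof [FU], which is an
argument because [null_seq] is a subspace only when [U] is a filter. *)
Definition null_seq (_ : Filter U) : {pred L} :=
  fun x => `[< x n @[n --> U] --> (0 : X) >].

Lemma null_seqP (x : L) :
  reflect (x n @[n --> U] --> (0 : X)) (x \in null_seq FU).
Proof. exact: asboolP. Qed.

Lemma null_seq_submod : submod_closed (null_seq FU).
Proof.
split; first by apply/null_seqP; exact: cvg_cst.
move=> a x y /null_seqP x0 /null_seqP y0; apply/null_seqP.
rewrite -[0 : X]addr0 -{1}(scaler0 X a).
by apply: cvgD => //; apply: cvgZl_tmp.
Qed.

HB.instance Definition _ :=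
  GRing.isSubmodClosed.Build K L (null_seq FU) null_seq_submod.

Definition ultrapower := Quotient.quot (null_seq FU).

HB.instance Definition _ := GRing.Zmodule.on ultrapower.
HB.instance Definition _ := EqQuotient.on ultrapower.

Definition ultrapower_class (x : L) : ultrapower := \pi_(ultrapower) x.

Lemma ultrapower_class_eqP (x y : L) :
  ultrapower_class x = ultrapower_class y <->
  x n - y n @[n --> U] --> (0 : X).
Proof.
have E : (x - y \in null_seq FU) = (ultrapower_class x == ultrapower_class y).
  exact: Quotient.idealrBE.
split=> [/eqP|/(null_seqP (x - y))]; first by rewrite -E => /null_seqP.
by rewrite E => /eqP.
Qed.

Lemma ultrapower_classK (q : ultrapower) : ultrapower_class (repr q) = q.
Proof. exact: reprK. Qed.

Lemma ultrapower_classD (x y : L) :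
  ultrapower_class (x + y) = ultrapower_class x + ultrapower_class y.
Proof. exact: Quotient.pi_add. Qed.

Definition ultrapower_scale (a : K) (q : ultrapower) : ultrapower :=
  ultrapower_class (a *: repr q).

Lemma ultrapower_classZ (a : K) (x : L) :
  ultrapower_class (a *: x) = ultrapower_scale a (ultrapower_class x).
Proof.
apply/eqP; rewrite -[_ == _]Quotient.idealrBE -scalerBr rpredZ//.
by rewrite Quotient.idealrBE reprK.
Qed.

Let ultrapower_scaleA (a b : K) (q : ultrapower) :
  ultrapower_scale a (ultrapower_scale b q) = ultrapower_scale (a * b) q.
Proof. by rewrite -ultrapower_classZ scalerA. Qed.

Let ultrapower_scale1 : left_id 1 ultrapower_scale.
Proof. by move=> q; rewrite /ultrapower_scale scale1r ultrapower_classK. Qed.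

Let ultrapower_scaleDr : right_distributive ultrapower_scale +%R.
Proof.
move=> a p q; rewrite -[p]ultrapower_classK -[q]ultrapower_classK.
by rewrite -ultrapower_classD -!ultrapower_classZ scalerDr ultrapower_classD.
Qed.

Let ultrapower_scaleDl (q : ultrapower) :
  {morph ultrapower_scale^~ q : a b / a + b}.
Proof. by move=> a b; rewrite /ultrapower_scale scalerDl ultrapower_classD. Qed.

HB.instance Definition _ := GRing.Zmodule_isLmodule.Build K ultrapower
  ultrapower_scaleA ultrapower_scale1 ultrapower_scaleDr ultrapower_scaleDl.

Definition ultrapower_norm (q : ultrapower) : K :=
  infimum 0 [set `|x| | x in [set x : L | ultrapower_class x = q]].

Lemma ultrapower_norm_infimums (q : ultrapower) :
  infimums [set `|x| | x in [set x : L | ultrapower_class x = q]]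
    (ultrapower_norm q).
Proof.
set A := [set _ | _ in _].
have Aq : A `|repr q| by exists (repr q) => //; exact: ultrapower_classK.
have lb0 : lbound A 0 by move=> _ [x _ <-].
have [s [ub_s lb_s]] : supremums (lbound A) !=set0.
  apply: rcK => [t /(_ _ Aq) tq /=|].
    by rewrite (ler_real tq) normr_real.
  by split; [exists 0|exists `|repr q| => t; exact].
have inf_s : infimums A s.
  by split=> // t At; apply: lb_s => u; exact.
rewrite /ultrapower_norm -/A /infimum; case: ifPn => [/eqP A0|_]; last first.
  by apply: xgetPex; exists s.
by rewrite A0 in Aq.
Qed.

Lemma ultrapower_norm_le (x : L) : ultrapower_norm (ultrapower_class x) <= `|x|.
Proof.
by have [lb _] := ultrapower_norm_infimums (ultrapower_class x); apply: lb; exists x.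
Qed.

Lemma ultrapower_norm_ge (q : ultrapower) t :
  (forall x : L, ultrapower_class x = q -> t <= `|x|) -> t <= ultrapower_norm q.
Proof.
by move=> tq; have [_ ub] := ultrapower_norm_infimums q; apply: ub => _ [x /tq ? <-].
Qed.

Let ultrapower_normD (p q : ultrapower) :
  ultrapower_norm (p + q) <= ultrapower_norm p + ultrapower_norm q.
Proof.
rewrite -lerBlDl; apply: ultrapower_norm_ge => y <-.
rewrite lerBlDl -lerBlDr; apply: ultrapower_norm_ge => x <-.
rewrite lerBlDr -ultrapower_classD.
exact: le_trans (ultrapower_norm_le _) (ler_normD _ _).
Qed.

Let ultrapower_norm_ge0 (q : ultrapower) : 0 <= ultrapower_norm q.
Proof. exact: ultrapower_norm_ge. Qed.

Let ultrapower_normZ_le (a : K) (q : ultrapower) :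
  ultrapower_norm (a *: q) <= `|a| * ultrapower_norm q.
Proof.
have [->|a0] := eqVneq a 0.
  have -> : 0 *: q = ultrapower_class 0.
    by rewrite -[q]ultrapower_classK -[LHS]ultrapower_classZ scale0r.
  by rewrite normr0 mul0r -[leRHS](normr0 L) ultrapower_norm_le.
rewrite -ler_pdivrMl ?normr_gt0//; apply: ultrapower_norm_ge => x <-.
rewrite ler_pdivrMl ?normr_gt0// -normrZ -[_ *: _]ultrapower_classZ.
exact: ultrapower_norm_le.
Qed.

Let ultrapower_normZ (a : K) (q : ultrapower) :
  ultrapower_norm (a *: q) = `|a| * ultrapower_norm q.
Proof.
apply/eqP; rewrite eq_le ultrapower_normZ_le /=.
have [->|a0] := eqVneq a 0; first by rewrite normr0 mul0r ultrapower_norm_ge0.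
rewrite -ler_pdivlMl ?normr_gt0// -normfV.
by rewrite -{1}(scalerK a0 q) ultrapower_normZ_le.
Qed.

Let ultrapower_norm0_eq0 (q : ultrapower) : ultrapower_norm q = 0 -> q = 0.
Proof.
move=> q0; rewrite -[q]ultrapower_classK.
have -> : 0 = ultrapower_class 0 by rewrite /ultrapower_class piE.
apply/ultrapower_class_eqP/cvgr0Pnorm_lt => e e0.
have e20 : 0 < e / 2 by rewrite divr_gt0.
have [y yq ye] : exists2 y : L, ultrapower_class y = q & `|y| < e / 2.
  apply: contrapT => noy; have : e / 2 <= ultrapower_norm q.
    apply: ultrapower_norm_ge => y yq; rewrite real_leNgt ?normr_real ?gtr0_real//.
    by apply/negP => ye; apply: noy; exists y.
  by rewrite q0 => /(lt_le_trans e20); rewrite ltxx.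
have /ultrapower_class_eqP/cvgr0Pnorm_lt/(_ _ e20) :
  ultrapower_class (repr q) = ultrapower_class y by rewrite ultrapower_classK.
apply: filterS => n xy; rewrite subr0 -[repr q n](subrK (y n)).
rewrite (le_lt_trans (ler_normD _ _))// [ltRHS]splitr ltrD//.
exact: le_lt_trans (linf_norm_ge y n) ye.
Qed.

HB.instance Definition _ := Lmodule_isNormed.Build K ultrapower
  ultrapower_normD ultrapower_normZ ultrapower_norm0_eq0.

Definition ultrapower_set (A : set X) : set ultrapower :=
  [set ultrapower_class x | x in [set x : L | forall n, A (x n)]].

End ultrapower.
Arguments ultrapower {K rcK} X U {FU}.
Arguments ultrapower_set {K rcK X} U {FU} A.

Definition free_filter (T : Type) (F : set_system T) :=
  \bigcap_(A in F) A = set0.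

Section super_weak_compactness.
Context {K : numFieldType} {rcK : real_complete K} {X : normedModType K}.

Definition relatively_super_weakly_compact (A : set X) :=
  forall (U : set_system nat) (UU : UltraFilter U), free_filter U ->
    relatively_weakly_compact (ultrapower_set U A).

Definition super_weakly_compact (A : set X) :=
  relatively_super_weakly_compact A /\ weakly_closed A.

End super_weak_compactness.

Definition property_R {K : numFieldType} {rcK : real_complete K}
    (X : normedModType K) :=
  forall A : set X, weakly_precompact A -> relatively_super_weakly_compact A.

(* Main.v *)
From HB Require Import structures.
Require Import Defs.
From mathcomp Require Import all_boot all_order all_algebra.
From mathcomp Require Import all_classical all_reals all_analysis.
From mathcomp Require Import complex ring.

(** (1) => (2): by Smulian's theorem weakly compact sets are weakly precompact,
and they are weakly closed because the weak topology is Hausdorff.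

(2) => (1): if A is weakly precompact and relatively weakly compact, (2) applied
to its weak closure shows that A is relatively super weakly compact. Otherwise
some F in the weak* closure of A in the bidual lies outside X, hence at positive
distance from X, and Helly's theorem yields x_n in A, functionals f_n in the
dual unit ball and d > 0 with f_k(x_j) = 0 for j < k and |f_k(x_j)| >= d for
k <= j. These relations pass to a weakly Cauchy subsequence y, for which the
differences y_(k+i+1) - y_k with i <= k tend weakly to 0 as k grows, uniformly
in i: together with 0 they form a weakly compact set D. In an ultrapower, the
classes of the sequences (y_(k+i+1) - y_k)_k, for i in N, satisfy the same
relations with respect to the functionals lim_k f_(k+j+1), so D is not super
weakly compact. *)

Set Implicit Arguments.
Unset Strict Implicit.
Unset Printing Implicit Defensive.

Import Order.TTheory GRing.Theory Num.Theory.
Import numFieldNormedType.Exports.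

Local Open Scope classical_set_scope.
Local Open Scope ring_scope.

(** * The Hahn-Banach theorem *)

Definition scalar_of (K : nzRingType) (V : lmodType K) (f : V -> K)
    (fl : scalar f) : {scalar V} :=
  HB.pack f (GRing.isLinear.Build K V K *%R f fl).

Definition linear_set (K : nzRingType) (V : lmodType K) (W : set V) :=
  W 0 /\ forall a u v, W u -> W v -> W (a *: u + v).

Definition dominated_graph (K : numDomainType) (V : lmodType K) (p : V -> K)
    (G : set (V * K^o)) := forall u, G u -> `|u.2| <= p u.1.

Definition seminorm (K : numDomainType) (V : lmodType K) (p : V -> K) :=
  (forall u v, p (u + v) <= p u + p v) /\
  (forall a u, p (a *: u) = `|a| * p u).

Lemma seminorm0 (K : numDomainType) (V : lmodType K) (p : V -> K) :
  seminorm p -> p 0 = 0.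
Proof. by move=> [_ pZ]; rewrite -(scale0r 0) pZ normr0 mul0r. Qed.

Lemma seminormN (K : numDomainType) (V : lmodType K) (p : V -> K) u :
  seminorm p -> p (- u) = p u.
Proof. by move=> [_ pZ]; rewrite -scaleN1r pZ normrN1 mul1r. Qed.

Lemma seminorm_ge0 (K : numDomainType) (V : lmodType K) (p : V -> K) u :
  seminorm p -> 0 <= p u.
Proof.
move=> ps; have := ps.1 u (- u).
by rewrite subrr (seminorm0 ps) (seminormN _ ps) -mulr2n pmulrn_lge0.
Qed.

(** A functional on a subspace is given by its graph; domination by a seminorm
makes the graph single-valued. *)
Definition hahn_banach (K : numDomainType) :=
  forall (V : lmodType K) (p : V -> K) (G : set (V * K^o)),
  seminorm p -> linear_set G -> dominated_graph p G ->
  exists2 f : {scalar V}, forall u, G u -> f u.1 = u.2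
                        & forall v, `|f v| <= p v.

Section real_hahn_banach.
Variables (R : realType) (V : lmodType R) (p : V -> R).
Hypothesis p_seminorm : seminorm p.

Let linear_dominated (G : set (V * R^o)) :=
  linear_set G /\ dominated_graph p G.

Let extend_graph (G : set (V * R^o)) (x : V) : linear_dominated G ->
  exists H : set (V * R^o),
    [/\ linear_dominated H, G `<=` H & exists c, H (x, c)].
Proof.
move=> [[G0 Glin] Gp].
(* Domination asks the value at [x] to lie above every [u.2 - p (u.1 - x)] and below every
   [v.2 + p (v.1 - x)]. By [cross] these two families do not overlap, so [sup B] is admissible. *)
pose B := [set u.2 - p (u.1 - x) | u in G].
have cross u v : G u -> G v -> u.2 - p (u.1 - x) <= v.2 + p (v.1 - x).
  move=> Gu Gv; rewrite lerBlDr -addrA -lerBlDl.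
  have : G (u - v) by rewrite addrC -scaleN1r; exact: Glin.
  move=> /Gp /=; move/(le_trans (ler_norm _))/le_trans; apply.
  rewrite -[leRHS]addrC -(seminormN (v.1 - x) p_seminorm).
  by apply: le_trans (p_seminorm.1 _ _); rewrite opprB addrA subrK addrC.
have B0 : B !=set0 by exists (0 - p (0 - x)), 0.
have ubB : has_ubound B.
  by exists (0 + p (0 - x)) => _ [u Gu <-]; apply: cross Gu G0.
have cG u : G u -> `|u.2 - sup B| <= p (u.1 - x).
  move=> Gu; rewrite ler_distlC; apply/andP; split.
    by apply: ub_le_sup => //; exists u.
  by apply: ge_sup => // _ [v Gv <-]; exact: cross.
pose z : V * R^o := (x, sup B).
exists [set w | exists u a, G u /\ w = u + a *: z]; split; last first.
- by exists (sup B), 0, 1; split => //; rewrite add0r scale1r.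
- by move=> u Gu; exists u, 0; split => //; rewrite scale0r addr0.
split; [split|].
- by exists 0, 0; split => //; rewrite scale0r addr0.
- move=> a _ _ [u [b [Gu ->]]] [v [c [Gv ->]]].
  exists (a *: u + v), (a * b + c); split; first exact: Glin.
  by rewrite scalerDr scalerA scalerDl addrACA.
- move=> _ [u [a [Gu ->]]]; have [->|a0] := eqVneq a 0.
    by rewrite scale0r addr0; exact: Gp.
  have /cG : G (- a^-1 *: u) by rewrite -[_ *: u]addr0; exact: Glin.
  move=> /(ler_wpM2l (normr_ge0 (- a))); rewrite -normrM -p_seminorm.2.
  (* Pulling out [- a] leaves the coefficient -1 at [z], the only case that [cG] treats. *)
  have -> : u + a *: z = - a *: (- a^-1 *: u - z).
    by rewrite scalerBr scalerA mulrNN mulfV// scale1r scaleNr opprK.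
  exact.
Qed.

Lemma real_hahn_banach (G : set (V * R^o)) : linear_set G ->
  dominated_graph p G ->
  exists2 f : {scalar V}, forall u, G u -> f u.1 = u.2
                        & forall v, `|f v| <= p v.
Proof.
move=> Glin Gp.
(* Zorn is applied to the part [A] added to [G], so that the empty chain too has its union in the
   family. For linearity and domination of a union, [chain] puts any two elements in a single good
   graph. *)
have [F FP Ftot|A [Agood Amax]] :=
    @Zorn_bigcup _ [set A | linear_dominated (G `|` A)].
  have chain u v : (G `|` \bigcup_(X in F) X) u -> (G `|` \bigcup_(X in F) X) v ->
      exists H, [/\ linear_dominated H, H u, H v &
                 H `<=` G `|` \bigcup_(X in F) X].
    have sub X : F X -> G `|` X `<=` G `|` \bigcup_(X in F) X.
      by move=> FX; apply: setUS; exact: bigcup_sup.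
    move=> [Gu|[X FX Xu]] [Gv|[Y FY Yv]].
    - by exists G; split.
    - by exists (G `|` Y); split; [exact: FP|left|right|exact: sub].
    - by exists (G `|` X); split; [exact: FP|right|left|exact: sub].
    - have [XY|YX] := Ftot _ _ FX FY.
        by exists (G `|` Y); split; [exact: FP|right; exact: XY|right|exact: sub].
      by exists (G `|` X); split; [exact: FP|right|right; exact: YX|exact: sub].
  split; [split|] => [|a u v Fu Fv|u Fu].
  - by left; exact: Glin.1.
  - have [H [[[_ Hlin] _] Hu Hv HF]] := chain _ _ Fu Fv.
    by apply: HF; exact: Hlin.
  - by have [H [[_ Hp] Hu _ _]] := chain _ _ Fu Fu; exact: Hp.
have [[GA0 GAlin] GAp] := Agood.
have GAtotal x : exists c : R, (G `|` A) (x, c).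
  have [H [Hgood GAH [c Hc]]] := extend_graph x Agood.
  exists c; apply: contrapT => GAc; apply: (Amax H); last first.
    by rewrite /= setUidr// => u Gu; apply: GAH; left.
  by split=> [u Au|HA]; [apply: GAH; right|apply: GAc; right; exact: HA].
have GAfun x c d : (G `|` A) (x, c) -> (G `|` A) (x, d) -> c = d.
  move=> xc xd; have /GAp : (G `|` A) (-1 *: (x, d) + (x, c)) by exact: GAlin.
  rewrite /= !scaleN1r addNr seminorm0// normr_le0 addrC subr_eq0.
  by move=> /eqP.
have /choice[f fGA] := GAtotal.
have flin : scalar f.
  by move=> a u v; apply: GAfun (fGA _) _; exact: (GAlin a (u, f u) (v, f v)).
exists (scalar_of flin) => [[x c] Gxc|v]; last exact: (GAp (v, f v)).
by apply: GAfun (fGA _) _; left.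
Qed.

End real_hahn_banach.

(** A separate name for [V], so that the real scaling does not compete with the complex one. *)
Definition realification (R : realType) (V : lmodType R[i]) : Type := V.

Section realification.
Variables (R : realType) (V : lmodType R[i]).
Local Notation VR := (realification V).

HB.instance Definition _ := GRing.Zmodule.on VR.

Let scaleR (a : R) (v : VR) : VR := (a%:C)%C *: (v : V).

Let scaleRA a b v : scaleR a (scaleR b v) = scaleR (a * b) v.
Proof. by rewrite /scaleR scalerA rmorphM. Qed.

Let scaleR1 : left_id 1 scaleR.
Proof. by move=> v; rewrite /scaleR rmorph1 scale1r. Qed.

Let scaleRDr : right_distributive scaleR +%R.
Proof. by move=> a u v; rewrite /scaleR scalerDr. Qed.

Let scaleRDl v : {morph scaleR^~ v : a b / a + b}.
Proof. by move=> a b; rewrite /scaleR rmorphD scalerDl. Qed.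

HB.instance Definition _ := GRing.Zmodule_isLmodule.Build R VR
  scaleRA scaleR1 scaleRDr scaleRDl.

Lemma realification_scale (a : R) (v : VR) : a *: v = (a%:C)%C *: (v : V).
Proof. by []. Qed.

End realification.

Lemma complex_hahn_banach (R : realType) : hahn_banach R[i].
Proof.
move=> V p G ps [G0 Glin] Gp.
have pE v : p v = ((complex.Re (p v))%:C)%C by rewrite RRe_real// ger0_real// seminorm_ge0.
pose q (v : realification V) := complex.Re (p v).
have qs : seminorm q.
  split=> [u v|a u]; first by have := ps.1 u v; rewrite pE (pE u) (pE v) -rmorphD lecR.
  by rewrite /q realification_scale ps.2 (pE u) normc_def/= expr0n addr0 sqrtr_sqr mulr0 subr0.
pose H := [set (u.1 : realification V, complex.Re u.2 : R^o) | u in G].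
have Hlin : linear_set H.
  split; first by exists 0.
  move=> a _ _ [u Gu <-] [v Gv <-]; exists ((a%:C)%C *: u + v); first exact: Glin.
  congr pair => /=.
  by case: u.2 v.2 => [b c] [d e]; rewrite /GRing.scale/=; simpc.
have Hq : dominated_graph q H.
  move=> _ [u Gu <-] /=; rewrite -lecR -pE.
  by apply: le_trans (Gp _ Gu); exact: normc_ge_Re.
have [h hH hq] := real_hahn_banach qs Hlin Hq.
(* A complex functional with real part [h] is [v |-> h v - i h(i v)]. *)
pose f (v : V) : R[i] := (h v +i* - h ('i%C *: v))%C.
have hD (u v : V) : h (u + v) = h u + h v by exact: (linearD h).
have hZ (a : R[i]) (v : V) : h (a *: v) = complex.Re a * h v + complex.Im a * h ('i%C *: v).
  have -> : a *: v = ((complex.Re a)%:C)%C *: v + ((complex.Im a)%:C)%C *: ('i%C *: v).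
    by rewrite scalerA -scalerDl; congr (_ *: v); case: a => a b; simpc.
  by rewrite hD; congr (_ + _); exact: (scalarZ h).
have flin : scalar f.
  move=> a u v; rewrite /f scalerDr !hD scalerA !(hZ a) (hZ ('i%C * a)).
  case: a => a b; simpc => /=; congr (_ +i* _)%C; ring.
exists (scalar_of flin) => [u Gu|v] /=.
  have Re_u w : G w -> h w.1 = complex.Re w.2 by move=> Gw; apply: (hH (w.1, _)); exists w.
  rewrite /f Re_u// (Re_u ('i%C *: u)); last by rewrite -[_ *: _]addr0; exact: Glin.
  have Re_i (c : R[i]) : complex.Re ('i%C * c) = - complex.Im c.
    by case: c => a b /=; rewrite mul0r mul1r sub0r.
  by rewrite [X in (_ -i* X)%C]Re_i opprK; case: (u.2).
have [->|fv0] := eqVneq (f v) 0; first by rewrite normr0 seminorm_ge0.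
(* Rotating [v] by the unimodular [c] makes [f] real there, hence equal to [h], without changing
   [p]. *)
pose c := `|f v| / f v.
have c1 : `|c| = 1 by rewrite normrM normfV normr_id divff// normr_eq0.
have fcv : f (c *: v) = `|f v|.
  have := flin c v 0; rewrite addr0 (_ : f 0 = 0) ?addr0 => [->|].
    by rewrite /c divfK.
  by rewrite /f scaler0 (linear0 h) oppr0.
have -> : `|f v| = ((h (c *: v))%:C)%C.
  by rewrite -[LHS]RRe_real ?normr_real// -fcv.
have -> : p v = p (c *: v) by rewrite ps.2 c1 mul1r.
by rewrite pE lecR (le_trans (ler_norm _))// hq.
Qed.

(** * Scalar fields *)

Lemma fmap_ultra T S (f : T -> S) (F : set_system T) :
  UltraFilter F -> UltraFilter (f @ F).
Proof.
move=> FU; constructor => [|G GF FG]; first exact: fmap_proper_filter.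
apply/seteqP; split=> // A GA.
have [//|FA] := in_ultra_setVsetC (f @^-1` A) FU.
by have [x []] := filter_ex (filterI GA (FG (~` A) FA)).
Qed.

(** The properties common to the real and the complex field on which the argument rests, together
    with [real_complete]; both cases are thus treated at once. *)
Record banach_scalars (K : numFieldType) : Prop := BanachScalars {
  compact_disk : forall r : K, compact [set x : K | `|x| <= r];
  archimedean_scalars : forall x : K, exists n, `|x| < n%:R;
  separable_scalars : exists d : nat -> K,
    forall x e, 0 < e -> exists n, `|x - d n| < e;
  hahn_banach_scalars : hahn_banach K }.

Section banach_scalars_instances.
Variable R : realType.

Let real_compact_disk (r : R) : compact [set x : R | `|x| <= r].
Proof.
rewrite (_ : [set x | _] = `[- r, r]%classic); first exact: segment_compact.
by apply/seteqP; split=> x /=; rewrite in_itv/= ler_norml.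
Qed.

Let real_separable : exists d : nat -> R,
  forall x e, 0 < e -> exists n, `|x - d n| < e.
Proof.
(* An enumeration of the rationals; numbers that code no rational give 0. *)
exists (fun n => ratr (odflt 0 (unpickle n))) => x e e0.
have [q] : exists q : rat, ratr q \in `](x - e), (x + e)[.
  by apply: rat_in_itvoo; rewrite ltrD2l gtrN.
by rewrite in_itv/= -ltr_distlC => qx; exists (pickle q); rewrite pickleK.
Qed.

Lemma real_banach_scalars : banach_scalars R.
Proof.
split; [exact: real_compact_disk| |exact: real_separable|].
  by move=> x; exists (Num.bound `|x|); apply: archi_boundP; exact: normr_ge0.
by move=> V p G ps; exact: real_hahn_banach.
Qed.

Let complex_le_ReIm (x : R[i]) :
  `|x| <= ((`|complex.Re x| + `|complex.Im x|)%:C)%C.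
Proof.
case: x => a b; have -> : (a +i* b = (a +i* 0) + (0 +i* b))%C by simpc.
rewrite (le_trans (ler_normD _ _))// !normc_def/= expr0n addr0 add0r.
by rewrite !sqrtr_sqr -rmorphD/= addr0 add0r.
Qed.

Let normc_ge_Im (x : R[i]) : ((`|complex.Im x|)%:C)%C <= `|x|.
Proof.
by case: x => a b; rewrite normc_def lecR/= -sqrtr_sqr ler_wsqrtr// lerDr sqr_ge0.
Qed.

Let C : numFieldType := R[i].

Let complex_compact_disk (r : C) : compact [set x : C | `|x| <= r].
Proof.
rewrite compact_ultra => F FU Fr.
have [x0 /= x0r] := filter_ex Fr.
have rE : r = ((complex.Re r)%:C)%C.
  by rewrite RRe_real// ger0_real// (le_trans _ x0r).
(* Real and imaginary part are bounded by the modulus, so each converges along [F] by compactness of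
   a real segment. *)
have coord (f : R[i] -> R) : (forall x, ((`|f x|)%:C)%C <= `|x|) ->
    exists a : R, f @ F --> a.
  move=> f_le; have := @real_compact_disk (complex.Re r); rewrite compact_ultra.
  move=> /(_ (f @ F) (fmap_ultra f FU))[|a [_ fa]]; last by exists a.
  change (F [set x | `|f x| <= complex.Re r]).
  by apply: filterS Fr => x /= xr; rewrite -lecR -rE (le_trans (f_le x)).
have [a Fa] := coord _ (@normc_ge_Re _).
have [b Fb] := coord _ normc_ge_Im.
have Fab : F --> ((a +i* b)%C : C).
  apply/cvgrPdist_lt => e e0.
  have eE : e = ((complex.Re e)%:C)%C by rewrite RRe_real// gtr0_real.
  have e20 : 0 < complex.Re e / 2 by rewrite divr_gt0// -ltcR -eE.
  move/cvgrPdist_lt/(_ _ e20): Fa => Fa; move/cvgrPdist_lt/(_ _ e20): Fb => Fb.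
  apply: filterS2 Fa Fb => x xa xb.
  rewrite (le_lt_trans (complex_le_ReIm _))// eE ltcR [ltRHS]splitr.
  by move: x xa xb => [x y] xa xb; exact: ltrD.
exists (a +i* b)%C; split => //=.
have abr e : 0 < e -> `|(a +i* b)%C : C| <= r + e.
  move=> e0; move/cvgrPdist_lt/(_ _ e0): Fab => Fab.
  have [x [xe xr]] := filter_ex (filterI Fab Fr).
  rewrite -[leLHS]/(`|(a +i* b : R[i])%C|) -(subrK (x : R[i]) (a +i* b)%C) addrC.
  rewrite (le_trans (ler_normD _ _))// lerD//.
  exact: ltW.
rewrite rE normc_def/= lecR; apply/ler_addgt0Pr => e e0.
have := abr ((e%:C)%C); rewrite ltcR => /(_ e0).
by rewrite rE -rmorphD normc_def lecR.
Qed.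

Let complex_separable : exists d : nat -> C,
  forall x e, 0 < e -> exists n, `|x - d n| < e.
Proof.
have [d dP] := real_separable.
exists (fun n => let m : nat * nat := odflt (0, 0)%N (unpickle n) in
  (d m.1 +i* d m.2)%C) => -[a b] e e0.
have eE : e = ((complex.Re e)%:C)%C by rewrite RRe_real// gtr0_real.
have e20 : 0 < complex.Re e / 2 by rewrite divr_gt0// -ltcR -eE.
have [[n an] [m bm]] := (dP a _ e20, dP b _ e20).
exists (pickle (n, m)); rewrite pickleK/=.
rewrite (le_lt_trans (complex_le_ReIm _))// eE ltcR [ltRHS]splitr.
exact: ltrD.
Qed.

Lemma complex_banach_scalars : banach_scalars R[i].
Proof.
split; [exact: complex_compact_disk| |exact: complex_separable|exact: complex_hahn_banach].
move=> x; exists (Num.bound (complex.Re `|x|)).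
rewrite -[ltLHS]RRe_real ?normr_real// -(rmorph_nat (real_complex R)) ltcR.
apply: archi_boundP; rewrite -lecR RRe_real ?normr_real//; exact: normr_ge0.
Qed.

End banach_scalars_instances.

Lemma near_inv_succ_lt (K : numFieldType) (bs : banach_scalars K) (e : K) :
  0 < e -> \forall n \near \oo, n.+1%:R^-1 < e.
Proof.
move=> e0; have [N eN] := archimedean_scalars bs e^-1; exists N => // n /= Nn.
rewrite invf_plt ?posrE// (lt_le_trans _ (_ : N%:R <= _))//.
  by rewrite -[e^-1]ger0_norm// invr_ge0 ltW.
by rewrite ler_nat leqW.
Qed.

(** * Weak topologies *)

(** If the preimage of some neighbourhood of [l] were not in [F], the trace of [F] on its complement
    would be proper, and an ultrafilter refining it would contradict the hypothesis. *)
Lemma cvg_ultra (T : Type) (S : topologicalType) (F : set_system T)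
    (h : T -> S) (l : S) : Filter F ->
  (forall G, UltraFilter G -> F `<=` G -> h @ G --> l) -> h @ F --> l.
Proof.
move=> FF FG A lA; apply: contrapT => FA.
have properF : ProperFilter (within (~` (h @^-1` A)) F).
  apply: Build_ProperFilter_ex => B FB; apply: contrapT => /forallNP B0.
  have {}FB : F [set x | ~ A (h x) -> B x] by exact: FB.
  apply: FA; change (F [set x | A (h x)]); apply: filterS FB => x xB.
  by apply: contrapT => /xB; exact: B0.
have [G [GU FGG]] := ultraFilterLemma properF.
have GA : G (h @^-1` A).
  apply: FG lA => // B FB; apply: FGG.
  change (F [set x | ~ A (h x) -> B x]).
  by apply: filterS FB => x Bx _.
have GA' : G (~` (h @^-1` A)) by apply: FGG; exact: withinT.
by have [x []] := filter_ex (filterI GA GA').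
Qed.

Section functionals.
Variables (K : numFieldType) (X : normedModType K).

Definition contractive (f : {scalar X}) := forall v, `|f v| <= `|v|.

Lemma scalar_continuous (f : {scalar X}) M :
  (forall v, `|f v| <= M * `|v|) -> continuous (f : X -> K).
Proof.
move=> fM; apply: (@bounded_linear_continuous K X K^o f).
apply/(@bounded_funP K X K^o f) => r; exists (`|M| * `|r|) => x xr.
rewrite (le_trans (fM x))// (le_trans (_ : _ <= `|M| * `|x|))//; last first.
  by rewrite ler_wpM2l// (le_trans xr)// real_ler_norm// -(ler_real xr) normr_real.
rewrite -[X in _ <= _ * X]normr_id -normrM real_ler_norm// ger0_real//.
exact: le_trans (fM x).
Qed.

Definition dual_of (f : {scalar X}) M (fM : forall v, `|f v| <= M * `|v|) :
  dual X := exist _ f (scalar_continuous fM).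

Lemma contractive_bounded (f : {scalar X}) : contractive f ->
  forall v, `|f v| <= 1 * `|v|.
Proof. by move=> fc v; rewrite mul1r. Qed.

Definition dual_contractive (f : {scalar X}) (fc : contractive f) : dual X :=
  dual_of (contractive_bounded fc).

Lemma dual_bounded (f : dual X) :
  exists2 M, 0 < M & forall v, `|sval f v| <= M * `|v|.
Proof.
case: f => f fc /=.
have /(@linear_boundedP K X K^o f) : bounded_near (f : X -> K^o) (nbhs (0 : X)).
  by apply/(@linear_bounded_continuous K X K^o f).
by move=> /pinfty_ex_gt0[M M0 fM]; exists M.
Qed.

Lemma norm_seminorm : seminorm (fun v : X => `|v|).
Proof. by split=> [u v|a v]; [exact: ler_normD|exact: normrZ]. Qed.

Lemma weak_cvgP {F : set_system X} {FF : Filter F} (x : X) :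
  F --> (x : weak X) <-> forall f : dual X, sval f v @[v --> F] --> sval f x.
Proof.
split=> [|Ff].
  move=> /(@cvg_sup _ _ _ F x) Fx f; have {}Fx := Fx f.
  apply: cvg_trans (@initial_continuous _ _ (sval f : X -> K) x).
  by apply: cvg_fmap2; exact: Fx.
apply/(@cvg_sup _ _ _ F x) => f A.
rewrite (@nbhsE (initial_topology (sval f : X -> K))) => -[_ [[B oB <-] /= Bx] BA].
have : F (sval f @^-1` B) by apply: (Ff f); exact: open_nbhs_nbhs.
exact: filterS.
Qed.

Lemma weak_closure_ultra (A : set X) (x : X) :
  closure (A : set (weak X)) x <->
  exists G : set_system X, [/\ UltraFilter G, G A & G --> (x : weak X)].
Proof.
split=> [|[G [GU GA Gx]] B /Gx GB]; last exact: filter_ex (filterI GA GB).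
rewrite closureEcvg => -[F FF [Fx AF]].
have [G [GU FG]] := ultraFilterLemma FF.
exists G; split=> //; last exact: cvg_trans Fx.
exact/FG/AF.
Qed.

End functionals.

Section scalar_limits.
Variables (K : numFieldType) (T : Type) (F : set_system T).
Context {FF : ProperFilter F}.
Implicit Types (h : T -> K) (l M : K).

Lemma scalar_cvg_unique h l m : h @ F --> l -> h @ F --> m -> l = m.
Proof. exact: (cvg_unique (@norm_hausdorff K K^o)). Qed.

Lemma scalar_cvg_dist h l e : h @ F --> l -> 0 < e ->
  \forall t \near F, `|l - h t| < e.
Proof. by move=> /(@cvgrPdist_lt K K^o _ F) hl /hl. Qed.

Lemma norm_cvg_le h l M : (\forall t \near F, `|h t| <= M) -> h @ F --> l ->
  `|l| <= M.
Proof.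
move=> hM hl; have [t tM] := filter_ex hM.
rewrite real_leNgt ?normr_real// -?(ler_real tM) ?normr_real//.
apply/negP => /(@cvgr_norm_gt K K^o _ F _ _ _ hl) => hM'.
have [s [/= sM sM']] := filter_ex (filterI hM hM').
by have := le_lt_trans sM sM'; rewrite ltxx.
Qed.

Lemma norm_cvg_ge h l M : M \is Num.real ->
  (\forall t \near F, M <= `|h t|) -> h @ F --> l -> M <= `|l|.
Proof.
move=> Mreal hM hl; rewrite real_leNgt ?normr_real//.
apply/negP => /(@cvgr_norm_lt K K^o _ F _ _ _ hl) => hM'.
have [s [/= sM sM']] := filter_ex (filterI hM hM').
by have := le_lt_trans sM sM'; rewrite ltxx.
Qed.

End scalar_limits.

Lemma ultra_bounded_cvg (K : numFieldType) (bs : banach_scalars K) T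
    (G : set_system T) (h : T -> K) (M : K) : UltraFilter G ->
  (\forall t \near G, `|h t| <= M) -> h @ G --> lim (h @ G).
Proof.
move=> GU hM; have := @compact_disk K bs M; rewrite compact_ultra.
by move=> /(_ _ (fmap_ultra h GU) hM)[l [_ hl]]; apply/cvg_ex; exists l.
Qed.

Section hahn_banach_consequences.
Variables (K : numFieldType) (X : normedModType K).
Hypothesis HB : hahn_banach K.

Lemma norming_functional (x : X) :
  exists2 f : {scalar X}, contractive f & f x = `|x|.
Proof.
pose G := [set (a *: x, a * `|x| : K^o) | a in [set: K]].
have [||f fG fc] := HB (@norm_seminorm _ X) (_ : linear_set G).
- split; first by exists 0 => //; rewrite scale0r mul0r.
  move=> a _ _ [b _ <-] [c _ <-]; exists (a * b + c) => //.
  by rewrite scalerDl mulrDl -scalerA -mulrA.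
- by move=> _ [a _ <-] /=; rewrite normrM normr_id normrZ.
exists f => //; apply: (fG (x, `|x|)); exists 1 => //.
by rewrite scale1r mul1r.
Qed.

(** On the span of [q] and [W] the functional sends [a *: q + w] to [a * e]; the distance from [q]
    to [W] bounds it by the norm, and Hahn-Banach extends it. *)
Lemma annihilating_functional (W : set X) (q : X) (e : K) : linear_set W ->
    0 < e -> (forall w, W w -> e <= `|q - w|) ->
  exists f : {scalar X}, [/\ contractive f, f q = e & forall w, W w -> f w = 0].
Proof.
move=> [W0 Wlin] e0 qW.
pose G := [set u : X * K^o | exists a w, W w /\ u = (a *: q + w, a * e)].
have [||f fG fc] := HB (@norm_seminorm _ X) (_ : linear_set G).
- split; first by exists 0, 0; rewrite scale0r mul0r addr0.
  move=> a _ _ [b [v [Wv ->]]] [c [w [Ww ->]]].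
  exists (a * b + c), (a *: v + w); split; first exact: Wlin.
  congr pair => /=; last by rewrite mulrDl -mulrA.
  by rewrite scalerDr scalerA scalerDl addrACA.
- move=> _ [a [w [Ww ->]]] /=; have [->|a0] := eqVneq a 0.
    by rewrite mul0r normr0.
  rewrite normrM (gtr0_norm e0) -[w](scalerKV a0) -scalerDr normrZ ler_wpM2l//.
  rewrite -[X in q + X]opprK; apply: qW.
  by rewrite -scaleNr -[_ *: w]addr0; exact: Wlin.
exists f; split=> // [|w Ww].
  by apply: (fG (q, e)); exists 1, 0; rewrite scale1r mul1r addr0.
by apply: (fG (w, 0)); exists 0, w; rewrite scale0r add0r mul0r.
Qed.

Lemma functionals_separate_points (x y : X) :
  (forall f : dual X, sval f x = sval f y) -> x = y.
Proof.
move=> fxy; have [f fc fN] := norming_functional (x - y).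
apply/eqP; rewrite -subr_eq0 -normr_eq0 -fN linearB/=.
by have /= -> := fxy (dual_contractive fc); rewrite subrr.
Qed.

Lemma weak_hausdorff : hausdorff_space (weak X).
Proof.
move=> x y; rewrite cluster_cvgE => -[G GF [Gy xG]].
apply: functionals_separate_points => f.
have xG' : G --> (x : weak X) by exact: xG.
exact: scalar_cvg_unique ((weak_cvgP _).1 xG' f) ((weak_cvgP _).1 Gy f).
Qed.

(** Mazur's theorem for subspaces: a functional vanishing on [W] but not at [q] would contradict
    weak convergence to [q] from within [W]. *)
Lemma weak_closure_linear (W : set X) (q : X) (e : K) : linear_set W ->
  closure (W : set (weak X)) q -> 0 < e -> exists2 w, W w & `|q - w| < e.
Proof.
move=> Wlin /weak_closure_ultra[G [GU GW Gq]] e0; apply: contrapT => qW.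
have [w Ww|f [fc fq fW]] := annihilating_functional Wlin e0 (q := q).
  rewrite real_leNgt ?normr_real ?(gtr0_real e0)//; apply/negP => qw.
  by apply: qW; exists w.
have fq' : f v @[v --> G] --> f q.
  exact: (weak_cvgP q).1 Gq (dual_contractive fc).
have : \forall w \near G, `|f q - f w| < e by exact: scalar_cvg_dist fq' e0.
move=> /(filterI GW)/filter_ex[w [/fW fw0 /=]].
by rewrite fq fw0 subr0 gtr0_norm// ltxx.
Qed.

(** A functional norming the limit point is bounded by [M] on [A], and this bound passes to the
    limit. *)
Lemma weak_closure_ball (A : set X) (M : K) : (forall x, A x -> `|x| <= M) ->
  forall x, closure (A : set (weak X)) x -> `|x| <= M.
Proof.
move=> AM x /weak_closure_ultra[G [GU GA Gx]].
have [f fc fx] := norming_functional x.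
rewrite -normr_id -fx.
apply: (norm_cvg_le (F := G)) ((weak_cvgP _).1 Gx (dual_contractive fc)).
by apply: filterS GA => v /AM; exact: le_trans.
Qed.

End hahn_banach_consequences.

(** * Smulian's theorem *)

Lemma increasing_selection (P : nat -> set nat) :
  (forall n N, exists2 m, (N < m)%N & P n m) ->
  exists2 phi : nat -> nat, {homo phi : m n / (m < n)%N} & forall n, P n (phi n).
Proof.
move=> infP; have /choice[s sP] : forall nN : nat * nat,
    exists m, (nN.2 < m)%N /\ P nN.1 m.
  by move=> [n N]; have [m] := infP n N; exists m.
pose phi := fix phi n := if n is n'.+1 then s (n, phi n') else s (0, 0)%N.
exists phi; last by case=> [|n]; [exact: (sP (0, 0)%N).2|exact: (sP (n.+1, phi n)).2].
by apply: homo_ltn => [? ? ?|n]; [exact: ltn_trans|exact: (sP (n.+1, phi n)).1].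
Qed.

Definition adherent_set (K : numFieldType) (X : normedModType K)
    (d : nat -> X) : set X := [set v | forall e, 0 < e -> exists n, `|v - d n| < e].

(** Finite combinations of the [x n] with coefficients from a countable dense set of scalars form a
    countable set, whose norm closure is a subspace. *)
Lemma separable_span (K : numFieldType) (bs : banach_scalars K)
    (X : normedModType K) (x : nat -> X) :
  exists d, linear_set (adherent_set d) /\ forall n, adherent_set d (x n).
Proof.
have [c cP] := separable_scalars bs.
pose comb (s : seq (nat * nat)) : X := \sum_(p <- s) c p.1 *: x p.2.
exists (fun n => comb (odflt [::] (unpickle n))).
set W := adherent_set _.
have WP v : W v <-> forall e, 0 < e -> exists s, `|v - comb s| < e.
  split=> Wv e /Wv[s vs]; first by exists (odflt [::] (unpickle s)).
  by exists (pickle s); rewrite pickleK.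
have approx1 a k e : 0 < e -> exists n, `|a *: x k - c n *: x k| < e.
  move=> e0; have xk0 : 0 < `|x k| + 1 by rewrite ltr_wpDl.
  have [n an] := cP a _ (divr_gt0 e0 xk0); exists n.
  rewrite -scalerBl normrZ (@le_lt_trans _ _ (`|a - c n| * (`|x k| + 1)))//.
    by rewrite ler_wpM2l// lerDl.
  by rewrite -ltr_pdivlMr.
(* The coefficients [c] need not be stable under products, so a multiple of a combination is
   approximated anew, term by term. *)
have approxZ a s e : 0 < e -> exists t, `|a *: comb s - comb t| < e.
  elim: s e => [|[n k] s IHs] e e0.
    by exists [::]; rewrite /comb big_nil scaler0 subr0 normr0.
  have e20 : 0 < e / 2 by rewrite divr_gt0.
  have [[m mP] [t tP]] := (approx1 (a * c n) k _ e20, IHs _ e20).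
  exists ((m, k) :: t); rewrite /comb !big_cons/= scalerDr opprD addrACA.
  by rewrite scalerA [ltRHS]splitr (le_lt_trans (ler_normD _ _))// ltrD.
split; last first.
  move=> n; apply/WP => e e0; have [m mP] := approx1 1 n e e0.
  by exists [:: (m, n)]; rewrite /comb big_seq1/= -{1}[x n]scale1r.
split; first by apply/WP => e e0; exists [::]; rewrite /comb big_nil subr0 normr0.
move=> a u v /WP Wu /WP Wv; apply/WP => e e0.
have e20 : 0 < e / 2 by rewrite divr_gt0.
have e40 : 0 < e / 2 / 2 by rewrite divr_gt0.
have a1 : 0 < `|a| + 1 by rewrite ltr_wpDl.
have [t vt] := Wv _ e20.
have [r ur] := Wu _ (divr_gt0 e40 a1).
have [s rs] := approxZ a r _ e40.
exists (s ++ t); rewrite /comb big_cat/= opprD addrACA [ltRHS]splitr.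
rewrite (le_lt_trans (ler_normD _ _))// ltrD//.
rewrite -[a *: u](subrK (a *: comb r)) -addrA [e / 2]splitr.
rewrite (le_lt_trans (ler_normD _ _))// ltrD// -scalerBr normrZ.
rewrite (@le_lt_trans _ _ ((`|a| + 1) * `|u - comb r|))//.
  by rewrite ler_wpM2r// lerDl.
by rewrite mulrC -ltr_pdivlMr.
Qed.

Lemma eventually_sub_ultra :
  exists G : set_system nat, UltraFilter G /\ \oo `<=` G.
Proof. exact: ultraFilterLemma. Qed.

Section smulian.
Variables (K : numFieldType) (bs : banach_scalars K) (X : normedModType K).

(** Since [f n] norms [d n] and kills [v], the norm of [d n] is at most that of [v - d n]. A [d n]
    closer to [v] than half the norm of [v] is then impossible. *)
Lemma adherent_set_separated (d : nat -> X) (f : nat -> {scalar X}) (v : X) :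
  (forall n, contractive (f n) /\ f n (d n) = `|d n|) ->
  adherent_set d v -> (forall n, f n v = 0) -> v = 0.
Proof.
move=> fd dv fv; apply: contrapT => /eqP; rewrite -normr_gt0 => v0.
have [n vn] := dv _ (divr_gt0 v0 (ltr0Sn _ 1)).
have dn : `|d n| <= `|v - d n|.
  have := (fd n).1 (v - d n).
  by rewrite linearB/= fv sub0r normrN (fd n).2 normr_id.
have : `|v| < `|v|.
  rewrite -{1}[v](subrK (d n)) [ltRHS]splitr (le_lt_trans (ler_normD _ _))//.
  by rewrite ltrD// (le_lt_trans dn).
by rewrite ltxx.
Qed.

(** A weak cluster point of [x] is determined, on the separable span of [x], by
the values of countably many functionals, so a subsequence along which these
converge has a unique weak cluster point. *)
Lemma weakly_compact_precompact (A : set X) :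
  weakly_compact A -> weakly_precompact A.
Proof.
move=> cA x Ax; rewrite /weakly_compact compact_ultra in cA.
have HB := hahn_banach_scalars bs.
have [d [Wlin Wx]] := separable_span bs x.
have /choice[f fP] : forall n, exists f : {scalar X}, contractive f /\ f (d n) = `|d n|.
  by move=> n; have [f fc fd] := norming_functional HB (d n); exists f.
(* Compactness gives the weak limit in [A]; Mazur's theorem keeps it in the separable subspace on
   which the [f n] separate points. *)
have lim_ultra (H : set_system nat) (phi : nat -> nat) : UltraFilter H ->
    exists y, [/\ A y, adherent_set d y &
      forall g : dual X, sval g (x (phi n)) @[n --> H] --> sval g y].
  move=> HU; have [||y [Ay Hy]] := cA ((x \o phi) @ H).
  - exact: fmap_ultra.
  - by apply: (@filterE _ H) => n; exact: Ax.
  exists y; split=> //; last by move=> g; exact: (weak_cvgP y).1 Hy g.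
  move=> e e0; have e20 : 0 < e / 2 by rewrite divr_gt0.
  have Wy : closure (adherent_set d : set (weak X)) y.
    apply/weak_closure_ultra; exists ((x \o phi) @ H); split=> //.
      exact: fmap_ultra.
    by apply: (@filterE _ H) => n; exact: Wx.
  have [w Ww yw] := weak_closure_linear HB Wlin Wy e20.
  have [n wn] := Ww _ e20; exists n.
  rewrite -[y](subrK w) -addrA [ltRHS]splitr.
  by rewrite (le_lt_trans (ler_normD _ _))// ltrD.
have [G [GU ooG]] := eventually_sub_ultra.
have [p [_ Wp Gp]] := lim_ultra G id GU.
pose fd n : dual X := dual_contractive (fP n).1.
(* A diagonal choice: at stage [n] the first [n.+1] functionals are within [n.+1%:R^-1] of their
   values at [p], so each [f k] converges along [phi]. *)
have [|phi phi_mono phiP] := @increasing_selection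
    (fun n => [set m | forall k : 'I_n.+1, `|f k p - f k (x m)| < n.+1%:R^-1]).
  move=> n N.
  have : G [set m | forall k : 'I_n.+1, `|f k p - f k (x m)| < n.+1%:R^-1].
    apply: filter_forall => k.
    have : f k (x m) @[m --> G] --> f k p by exact: (Gp (fd k)).
    by move/scalar_cvg_dist; apply; rewrite invr_gt0.
  have /ooG GN : \oo [set m | (N < m)%N] by exact: nbhs_infty_gt.
  by move=> /(filterI GN)/filter_ex[m [/= Nm mP]]; exists m.
exists phi => // g; apply/cvg_ex; exists (sval g p).
(* Along any ultrafilter finer than [\oo] the subsequence has a weak limit [y]; all [f k] agree at
   [y] and [p], so [y] is [p]. *)
apply: cvg_ultra => H HU ooH.
have [y [Ay Wy Hy]] := lim_ultra H phi HU.
suff -> : p = y by exact: Hy.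
apply/esym/eqP; rewrite -subr_eq0; apply/eqP.
apply: (adherent_set_separated fP) => [|k].
  by rewrite addrC -scaleN1r; exact: Wlin.2.
rewrite linearB/=; apply/eqP; rewrite subr_eq0; apply/eqP.
apply: (scalar_cvg_unique (F := H) (h := fun n => f k (x (phi n)))).
  exact: (Hy (fd k)).
apply/(@cvgrPdist_lt K K^o _ H) => e e0.
apply: ooH.
apply: filterS2 (near_inv_succ_lt bs e0) (nbhs_infty_ge k) => n ne kn.
by have := phiP n (inord k); rewrite inordK ?ltnS// => /lt_trans; apply.
Qed.

End smulian.

(** * Boundedness of weakly precompact sets *)

Lemma leq_homo_ltn (phi : nat -> nat) n :
  {homo phi : m n / (m < n)%N} -> (n <= phi n)%N.
Proof.
by move=> phi_mono; elim: n => // n IHn; exact: leq_ltn_trans IHn (phi_mono _ _ _).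
Qed.

Section ultralimit.
Variables (K : numFieldType) (bs : banach_scalars K) (V : lmodType K).
Variables (T : Type) (G : set_system T).
Context {GU : UltraFilter G}.

(** Linearity is asked only in the limit, so that [h] may also be computed on chosen representatives
    in an ultrapower, where it is linear only up to null sequences. *)
Lemma ultralimit_scalar (h : V -> T -> K) :
  (forall v, exists M : K, \forall t \near G, `|h v t| <= M) ->
  (forall a u v, (h (a *: u + v) t - (a * h u t + h v t)) @[t --> G] --> (0 : K)) ->
  exists L : {scalar V}, forall v, h v @ G --> L v.
Proof.
move=> hM hlin.
have hL v : h v @ G --> lim (h v @ G).
  by have [M vM] := hM v; exact: ultra_bounded_cvg vM.
have Llin : scalar (fun v => lim (h v @ G)).
  move=> a u v; apply: (scalar_cvg_unique (hL _)).
  rewrite -[X in _ --> X]add0r.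
  rewrite [X in X @ G](_ : _ = fun t => h (a *: u + v) t - (a * h u t + h v t)
    + (a * h u t + h v t)); last by apply/funext => t; rewrite subrK.
  apply: (@cvgD K K^o _ G); first exact: hlin.
  apply: (@cvgD K K^o _ G); last exact: hL.
  by apply: (@cvgMl_tmp K _ G _); exact: hL.
by exists (scalar_of Llin).
Qed.

End ultralimit.

Section boundedness.
Variables (K : numFieldType) (bs : banach_scalars K) (X : normedModType K).

(** If [f] norms [x], the values of [g + r f] and [g - r f] at [x] differ by twice [r] times the
    norm of [x], so one of them is large enough. *)
Lemma perturbed_functional (g : X -> K) (r : K) (x : X) : 0 < r -> scalar g ->
  exists h : X -> K, [/\ scalar h, forall v, `|h v - g v| <= r * `|v| &
                         r * `|x| <= `|h x|].
Proof.
move=> r0 glin.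
have [f fc fx] := norming_functional (hahn_banach_scalars bs) x.
pose h (e : K) v := g v + e * r * f v.
have hlin e : scalar (h e).
  move=> a u v; rewrite /h glin linearD/= linearZ/= mulrDr mulrDr addrACA.
  by rewrite mulrCA.
have hg e v : `|e| = 1 -> `|h e v - g v| <= r * `|v|.
  move=> e1; rewrite addrAC subrr add0r !normrM e1 mul1r gtr0_norm//.
  by rewrite ler_wpM2l ?(ltW r0)//; exact: fc.
have [h1|] := boolP (r * `|x| <= `|h 1 x|).
  by exists (h 1); split=> // v; apply: hg; rewrite normr1.
rewrite -real_ltNge ?ger0_real ?mulr_ge0 ?(ltW r0)// => h1.
exists (h (-1)); split=> // [v|]; first by apply: hg; rewrite normrN1.
rewrite real_leNgt ?ger0_real ?mulr_ge0 ?(ltW r0)//; apply/negP => h2.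
have := ltrD h1 h2; rewrite -[`|h (-1) x|]normrN => /(le_lt_trans (ler_normD _ _)).
rewrite /h fx mul1r mulN1r mulNr opprD opprK addrACA subrr add0r -mulr2n.
by rewrite normrMn normrM normr_id gtr0_norm// ltxx.
Qed.

(** Gliding hump: the [n]-th perturbation, of norm [3^-n], makes the functional
large at [x n], and the sum of the later ones is too small to undo it. *)
Lemma weakly_precompact_bounded (A : set X) : weakly_precompact A ->
  exists2 M, 0 <= M & forall x, A x -> `|x| <= M.
Proof.
move=> pA; apply: contrapT => unbA.
(* The perturbations after the [n]-th add up to at most [3 / 2 * r n.+1], which is [r n / 2]. Half
   of the size gained at [x n] therefore survives in the limit, and [xP] makes this half at least
   [n]. *)
pose r n : K := 3^-1 ^+ n.
have r0 n : 0 < r n by rewrite exprn_gt0// invr_gt0.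
have /choice[x xP] : forall n, exists x, A x /\ n%:R <= r n / 2 * `|x|.
  move=> n; apply: contrapT => noX; apply: unbA.
  exists ((r n / 2)^-1 * n%:R) => [|x Ax].
    by rewrite mulr_ge0// invr_ge0 divr_ge0// ltW.
  rewrite ler_pdivlMl ?divr_gt0// real_leNgt ?ger0_real ?mulr_ge0 ?divr_ge0 ?(ltW (r0 n))//.
  by apply/negP => /ltW nx; apply: noX; exists x.
have /choice[s sP] : forall ng : nat * {scalar X}, exists h : {scalar X},
    (forall v, `|h v - ng.2 v| <= r ng.1 * `|v|) /\
    r ng.1 * `|x ng.1| <= `|h (x ng.1)|.
  move=> [n g]; have [h [hlin hg hx]] := perturbed_functional (x n) (r0 n) (linearP g).
  by exists (scalar_of hlin).
have [f0 f0c _] := norming_functional (hahn_banach_scalars bs) (0 : X).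
pose g := fix g n : {scalar X} := if n is m.+1 then s (m, g m) else f0.
have gP n : (forall v, `|g n.+1 v - g n v| <= r n * `|v|) /\
  r n * `|x n| <= `|g n.+1 (x n)| by exact: (sP (n, g n)).
(* The factor [3 / 2 * (r n - r (n + m))] is the geometric sum of [r n], ..., [r (n + m - 1)]. *)
have gD n m v : `|g (n + m)%N v - g n v| <= 3 / 2 * (r n - r (n + m)%N) * `|v|.
  elim: m => [|m IHm]; first by rewrite addn0 !subrr mulr0 mul0r normr0.
  rewrite addnS -[g (n + m).+1 v](subrK (g (n + m)%N v)) -addrA.
  rewrite (le_trans (ler_normD _ _))// (le_trans (lerD ((gP _).1 v) IHm))//.
  rewrite -mulrDl ler_wpM2r// /r exprS.
  set a := _ ^+ (n + m)%N; set b := _ ^+ n.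
  suff -> : 3 / 2 * (b - 3^-1 * a) = a + 3 / 2 * (b - a) by [].
  by field.
have r1 n : r n <= 1 by rewrite exprn_ile1// ?invr_ge0// invf_le1 ?ltr0n// ler1n.
have [G [GU ooG]] := eventually_sub_ultra.
have [||L Lg] := @ultralimit_scalar K bs X _ G GU (fun v n => g n v).
- move=> v; exists (`|g 0 v| + 3 / 2 * `|v|); apply: filterE => n.
  rewrite -[g n v](subrK (g 0 v)) addrC (le_trans (ler_normD _ _))// lerD//.
  rewrite (le_trans (gD 0 n v))// ler_wpM2r// -[leRHS]mulr1 ler_wpM2l ?divr_ge0//.
  by rewrite /r expr0 gerBl ltW.
- move=> a u v; rewrite [X in X @ _](_ : _ = fun=> 0); last first.
    by apply/funext => n; rewrite linearP subrr.
  exact: (@cvg_cst K).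
have Ln n v : `|L v - g n v| <= 3 / 2 * r n * `|v|.
  apply: (norm_cvg_le (F := G) (h := fun m => g m v - g n v)); last first.
    by apply: (@cvgB K K^o _ G); [exact: Lg|exact: cvg_cst].
  have /ooG : \oo [set m | (n <= m)%N] by exact: nbhs_infty_ge.
  apply: filterS => m /= nm; rewrite -(subnKC nm) (le_trans (gD n (m - n)%N v))//.
  by rewrite ler_wpM2r// ler_wpM2l ?divr_ge0// gerBl ltW.
have Lx n : n%:R <= `|L (x n)|.
  have [_ nx] := xP n; apply: (le_trans nx).
  have := (gP n).2; rewrite -[g n.+1 (x n)](subrK (L (x n))) => /le_trans.
  move=> /(_ _ (ler_normD _ _)); rewrite -lerBlDl; apply: le_trans.
  rewrite lerBrDl -lerBrDr (le_trans (_ : _ <= 3 / 2 * r n.+1 * `|x n|))//.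
    by rewrite distrC Ln.
  rewrite -mulrBl ler_wpM2r// /r exprS; set a := _ ^+ n.
  by rewrite (_ : 3 / 2 * (3^-1 * a) = a - a / 2)//; field.
have [phi phi_mono xc] := pA x (fun n => (xP n).1).
have Lbound v : `|L v| <= (3 / 2 + 1) * `|v|.
  rewrite -[L v](subrK (g 0 v)) (le_trans (ler_normD _ _))// mulrDl mul1r lerD//.
    by rewrite (le_trans (Ln 0 v))// /r expr0 mulr1.
have /cvg_ex[l xl] := xc (dual_of Lbound).
(* The values of [L] along the subsequence converge to [l], yet by [Lx] and [m <= phi m] they are at
   least [n] in modulus once [n <= m]. *)
have [n ln] := archimedean_scalars bs (`|l| + 1).
have : \forall m \near \oo, `|l - L (x (phi m))| < 1 by exact: scalar_cvg_dist xl _.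
have : \forall m \near \oo, (n <= m)%N by exact: nbhs_infty_ge.
move=> nm /(filterI nm)/filter_ex[m [/= {}nm lm]].
suff : n%:R < n%:R :> K by rewrite ltxx.
rewrite ger0_norm ?addr_ge0// in ln.
apply: (le_lt_trans (le_trans _ (Lx (phi m))) (lt_trans _ ln)).
  by rewrite ler_nat (leq_trans nm)//; exact: leq_homo_ltn.
rewrite -[L _](subrK l) addrC (le_lt_trans (ler_normD _ _))//.
by rewrite ltrD2l distrC.
Qed.

End boundedness.

(** * Helly's theorem *)

Section bounded_functionals.
Variables (K : numFieldType) (X : normedModType K).

(** The dual once more, now as a submodule of the functions: elements of the bidual become linear
    functionals on it, and Hahn-Banach applies to it. *)
Definition bounded_functional_pred : {pred X -> K^o} := fun f =>
  `[< scalar f /\ exists2 M, 0 <= M & forall v, `|f v| <= M * `|v| >].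

Lemma bounded_functional_submod : submod_closed bounded_functional_pred.
Proof.
split=> [|a f g /asboolP[flin [M M0 fM]] /asboolP[glin [N N0 gN]]].
  apply/asboolP; split; first by move=> a u v; rewrite /= mulr0 addr0.
  by exists 0 => // v; rewrite normr0 mul0r.
apply/asboolP; split=> [b u v|].
  rewrite -[LHS]/(a * f (b *: u + v) + g (b *: u + v)) flin glin.
  by rewrite mulrDr addrACA mulrCA -mulrDr.
exists (`|a| * M + N) => [|v]; first by rewrite addr_ge0// mulr_ge0.
rewrite (le_trans (ler_normD _ _))// mulrDl lerD//.
by rewrite -mulrA [leLHS]normrM ler_wpM2l.
Qed.

HB.instance Definition _ := GRing.isSubmodClosed.Build K (X -> K^o)
  bounded_functional_pred bounded_functional_submod.

Record bounded_functional := BoundedFunctional {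
  bf_val :> X -> K^o ; bf_valP : bf_val \in bounded_functional_pred }.

HB.instance Definition _ := [isSub for bf_val].
HB.instance Definition _ := [Choice of bounded_functional by <:].
HB.instance Definition _ := [SubChoice_isSubLmodule of bounded_functional by <:].

Lemma bf_scalar (f : bounded_functional) : scalar f.
Proof. by have /asboolP[] := bf_valP f. Qed.

Lemma bf_linearE a (f g : bounded_functional) v :
  (a *: f + g) v = a * f v + g v.
Proof. by []. Qed.

Definition bf_of (f : {scalar X}) M (M0 : 0 <= M)
    (fM : forall v, `|f v| <= M * `|v|) : bounded_functional.
Proof.
apply: (@BoundedFunctional f); apply/asboolP; split; first exact: linearP.
by exists M.
Defined.

Definition bf_norm (f : bounded_functional) : K :=
  supremum 0 [set `|f v| | v in [set v | `|v| <= 1]].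

Hypothesis rcK : real_complete K.

Lemma bf_norm_supremums (f : bounded_functional) :
  supremums [set `|f v| | v in [set v | `|v| <= 1]] (bf_norm f).
Proof.
set A := [set _ | _ in _].
have A0 : A `|f 0| by exists 0 => //=; rewrite normr0.
have [s sup_s] : supremums A !=set0.
  apply: rcK => [_ [v _ <-] /=|]; first exact: normr_real.
  split; first by exists `|f 0|.
  have /asboolP[_ [M M0 fM]] := bf_valP f.
  exists M => _ [v v1 <-]; rewrite (le_trans (fM v))// -[leRHS]mulr1.
  by rewrite ler_wpM2l.
rewrite /bf_norm -/A /supremum; case: ifPn => [/eqP A00|_]; last first.
  by apply: xgetPex; exists s.
by rewrite A00 in A0.
Qed.

Lemma bf_norm_ge0 (f : bounded_functional) : 0 <= bf_norm f.
Proof.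
have [ub _] := bf_norm_supremums f; apply: le_trans (ub `|f 0| _) => //.
by exists 0 => //=; rewrite normr0.
Qed.

Lemma bf_norm_bound (f : bounded_functional) v : `|f v| <= bf_norm f * `|v|.
Proof.
have flin := bf_scalar f; have fZ a u : f (a *: u) = a * f u.
  have := flin a u 0; rewrite addr0 => ->.
  have := flin (-1) 0 0; rewrite scaler0 addr0 => ->.
  by rewrite mulN1r addNr addr0.
have [->|v0] := eqVneq v 0.
  by rewrite -(scale0r 0) fZ mul0r !normr0 normrZ normr0 mul0r mulr0.
have [ub _] := bf_norm_supremums f.
rewrite -ler_pdivrMr ?normr_gt0// mulrC -[X in X * _]ger0_norm ?invr_ge0// -normrM.
rewrite -fZ; apply: ub; exists (`|v|^-1 *: v) => //=.
by rewrite normrZ normfV normr_id mulVf// normr_eq0.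
Qed.

Lemma bf_norm_le (f : bounded_functional) t : 0 <= t ->
  (forall v, `|f v| <= t * `|v|) -> bf_norm f <= t.
Proof.
move=> t0 ft; have [_ lb] := bf_norm_supremums f; apply: lb => _ [v v1 <-].
by rewrite (le_trans (ft v))// -[leRHS]mulr1 ler_wpM2l.
Qed.

Lemma bf_norm_seminorm : seminorm bf_norm.
Proof.
have le_Z a f : bf_norm (a *: f) <= `|a| * bf_norm f.
  apply: bf_norm_le => [|v]; first by rewrite mulr_ge0// bf_norm_ge0.
  rewrite -mulrA [leLHS](_ : _ = `|a| * `|f v|) ?normrM//.
  by rewrite ler_wpM2l// bf_norm_bound.
split=> [f g|a f].
  apply: bf_norm_le => [|v]; first by rewrite addr_ge0// bf_norm_ge0.
  by rewrite mulrDl (le_trans (ler_normD _ _))// lerD// bf_norm_bound.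
apply/eqP; rewrite eq_le le_Z/=; have [->|a0] := eqVneq a 0.
  by rewrite normr0 mul0r bf_norm_ge0.
by rewrite -ler_pdivlMl ?normr_gt0// -normfV -{1}(scalerK a0 f).
Qed.

End bounded_functionals.

Section helly.
Variables (K : numFieldType) (rcK : real_complete K) (X : normedModType K).
Hypothesis HB : hahn_banach K.
Local Notation B := (bounded_functional X).

(** A functional vanishing on the common kernel of finitely many functionals is a combination of
    them; a combination of evaluations is again an evaluation. *)
Lemma evaluation_combination (L : {scalar B}) (s : seq X) :
  (forall f : B, (forall x, x \in s -> f x = 0) -> L f = 0) ->
  exists x, forall f : B, L f = f x.
Proof.
elim: s L => [|x s IHs] L Ls.
  exists 0 => f; rewrite Ls//; have := bf_scalar f (-1) 0 0.
  by rewrite scaler0 addr0 mulN1r addNr.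
have [sx|] := pselect (forall f : B, (forall y, y \in s -> f y = 0) -> f x = 0).
  apply: IHs => f fs; apply: Ls => y; rewrite inE => /predU1P[->|]; first exact: sx.
  exact: fs.
move=> /existsNP[f0 /not_implyP[f0s /eqP f0x]].
(* [f1] is 1 at [x] and 0 on [s]. Subtracting [f x *: f1] from [f] brings it to 0 at [x] and keeps
   its values on [s], which reduces [L] to a functional for [s] alone. *)
pose f1 := (f0 x)^-1 *: f0.
have f1x : f1 x = 1 by exact: mulVf.
have f1s y : y \in s -> f1 y = 0.
  by move=> /f0s f0y; rewrite -[LHS]/(_ * f0 y) f0y mulr0.
have L'lin : scalar (fun f : B => L f - f x * L f1).
  move=> a f g; have -> : (a *: f + g) x = a * f x + g x by [].
  by rewrite linearP mulrDl mulrBr opprD addrACA mulrA.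
have [f fs|y Ly] := IHs (scalar_of L'lin).
  change (L f - f x * L f1 = 0).
  have -> : L f - f x * L f1 = L (f - f x *: f1) 
    by rewrite linearB; congr (_ - _); exact/esym/scalarZ.
  apply: Ls => y.
  rewrite -[(f - _) y]/(f y - f x * f1 y) inE => /predU1P[->|ys].
    by rewrite f1x mulr1 subrr.
  by rewrite fs// f1s// mulr0 subrr.
exists (L f1 *: x + y) => f; rewrite bf_scalar -Ly/= mulrC addrC subrK//.
Qed.

(** Otherwise the restriction of [F] to the annihilator of [s] extends to [L] of
norm at most [d / 2]; as [F - L] vanishes on the annihilator, it is the
evaluation at some [x], and [F] is within [d / 2] of [x]. *)
Lemma helly (F : {scalar B}) (d : K) (s : seq X) : 0 < d ->
  (forall x, exists2 f : B, (forall v, `|f v| <= `|v|) & d <= `|F f - f x|) ->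
  exists f : B, [/\ forall v, `|f v| <= `|v|, forall x, x \in s -> f x = 0 &
                    d / 2 <= `|F f|].
Proof.
move=> d0 dF; apply: contrapT => nof.
have d20 : 0 < d / 2 by rewrite divr_gt0.
have Fs (f : B) : (forall x, x \in s -> f x = 0) -> `|F f| <= d / 2 * bf_norm f.
  move=> fs; have := bf_norm_ge0 rcK f; rewrite le_eqVlt => /predU1P[f0|f0].
    rewrite -f0 mulr0 (_ : f = 0) ?linear0 ?normr0//.
    apply/val_inj/funext => v; apply/eqP; rewrite -normr_le0.
    by rewrite (le_trans (bf_norm_bound rcK f v))// -f0 mul0r.
  rewrite -ler_pdivrMr// real_leNgt ?ger0_real ?divr_ge0 ?(ltW d0) ?(ltW d20) ?(ltW f0)//.
  apply/negP => fd; apply: nof; exists ((bf_norm f)^-1 *: f); split.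
  - move=> v; rewrite [leLHS]normrM normfV (gtr0_norm f0) ler_pdivrMl//.
    exact: bf_norm_bound.
  - by move=> x xs; rewrite -[LHS]/(_ * f x) fs// mulr0.
  - by rewrite scalarZ normrM normfV (gtr0_norm f0) [leRHS]mulrC ltW.
have ps : seminorm (fun f : B => d / 2 * bf_norm f).
  have [nD nZ] := bf_norm_seminorm X rcK.
  by split=> [f g|a f]; rewrite -?mulrDr ?ler_wpM2l ?(ltW d20)// nZ mulrCA.
pose G : set (B * K^o) :=
  [set u : B * K^o | (forall x, x \in s -> u.1 x = 0) /\ u.2 = F u.1].
have [||L LG Ld] := HB ps (_ : linear_set G).
- split; first by split=> //=; rewrite linear0.
  move=> a u v [us uF] [vs vF]; split; last by rewrite /= uF vF linearP.
  move=> x xs; apply: etrans (bf_linearE a u.1 v.1 x) _.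
  by rewrite (us _ xs) (vs _ xs) mulr0 addr0.
- by move=> [f c] [/= fs ->]; exact: Fs.
have FLlin : scalar (fun f : B => F f - L f).
  by move=> a f g; rewrite (linearP F) (linearP L) mulrBr opprD addrACA.
have [f fs|x Fx] := evaluation_combination (L := scalar_of FLlin) (s := s).
  by rewrite /= (LG (f, F f))// subrr.
have [f f1 dF'] := dF x.
have : d <= d / 2.
  apply: le_trans dF' _; rewrite -Fx/= opprB addrC subrK.
  rewrite (le_trans (Ld f))// -[leRHS]mulr1 ler_wpM2l ?(ltW d20)//.
  by apply: bf_norm_le => // v; rewrite mul1r.
have d2 : d / 2 < d by rewrite gtr_pMr// invf_lt1// ltr1n.
by move=> /le_lt_trans/(_ d2); rewrite ltxx.
Qed.

End helly.

(** * James sequences *)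

Lemma prefix_dependent_choice (T : Type) (P : seq T -> T -> Prop) :
  (forall s, exists t, P s t) -> exists u : nat -> T, forall n, P (mkseq u n) (u n).
Proof.
move=> /choice[c cP]; pose s := fix s n := if n is m.+1 then rcons (s m) (c (s m)) else [::].
exists (c \o s) => n; suff -> : mkseq (c \o s) n = s n by exact: cP.
by elim: n => // n IHn; rewrite mkseqS IHn.
Qed.

Lemma near_all_seq (T : eqType) S (F : set_system S) (s : seq T)
    (P : T -> set S) : Filter F ->
  (forall t, t \in s -> F (P t)) -> F [set y | forall t, t \in s -> P t y].
Proof.
move=> FF; elim: s => [|t s IHs] sP; first by apply: filterE => y.
have Ft : F (P t) by apply: sP; rewrite mem_head.
have /IHs Fs : forall r, r \in s -> F (P r).
  by move=> r rs; apply: sP; rewrite inE rs orbT.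
by apply: filterS2 Ft Fs => y ty sy r; rewrite inE => /predU1P[->|/sy].
Qed.

(** The triangular pattern of James's characterisation of weak noncompactness: it keeps every weak
    cluster point of [x] at distance at least [d] from the span of [x]. *)
Definition james_sequence (K : numFieldType) (X : normedModType K)
    (x : nat -> X) (f : nat -> {scalar X}) (d : K) :=
  [/\ forall k, contractive (f k),
      forall j k, (j < k)%N -> f k (x j) = 0 &
      forall k j, (k <= j)%N -> d <= `|f k (x j)|].

Section eberlein.
Variables (K : numFieldType) (bs : banach_scalars K) (rcK : real_complete K).

(** A complete space is closed in its bidual: approximants of [L] on the dual ball form a Cauchy
    sequence, by norming functionals, and its limit represents [L]. *)
Lemma ultralimit_of_contractive_approx (X : completeNormedModType K)
    (L : {scalar bounded_functional X}) :
  (forall e, 0 < e -> exists x, forall f : bounded_functional X,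
    (forall v, `|f v| <= `|v|) -> `|L f - f x| < e) ->
  exists x, forall f : bounded_functional X, L f = f x.
Proof.
move=> Lx; have /choice[x xP] : forall n, exists x, forall f : bounded_functional X,
    (forall v, `|f v| <= `|v|) -> `|L f - f x| < n.+1%:R^-1.
  by move=> n; apply: Lx; rewrite invr_gt0.
have xD n m : `|x n - x m| <= n.+1%:R^-1 + m.+1%:R^-1.
  have [f fc fx] := norming_functional (hahn_banach_scalars bs) (x n - x m).
  rewrite -normr_id -fx.
  pose g := bf_of ler01 (contractive_bounded fc).
  rewrite linearB/= -(subrK (L g) (f (x n))) -addrA.
  rewrite (le_trans (ler_normD _ _))// lerD// ltW//; last exact: (xP m g).
  by rewrite distrC; exact: (xP n g).
have : cvg (x @ \oo).
  apply/cauchy_cvgP/cauchy_exP => e e0.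
  have [N _ Ne] := near_inv_succ_lt bs (divr_gt0 e0 (ltr0Sn _ 1)).
  exists (x N); exists N => // n /= Nn; rewrite -ball_normE/=.
  by rewrite (le_lt_trans (xD _ _))// [ltRHS]splitr ltrD// Ne/=.
move=> /cvg_ex[p xp]; exists p.
have Lp (f : bounded_functional X) : (forall v, `|f v| <= `|v|) -> L f = f p.
  move=> fc; apply: contrapT => /eqP; rewrite -subr_eq0 -normr_gt0.
  set t := `|_| => t0; have t20 : 0 < t / 2 by rewrite divr_gt0.
  have xpt : \forall n \near \oo, `|p - x n| < t / 2.
    by move/cvgrPdist_lt : xp; apply.
  have [n [/= nt xnp]] := filter_ex (filterI (near_inv_succ_lt bs t20) xpt).
  suff : t < t by rewrite ltxx.
  rewrite {1}/t -(subrK (f (x n)) (L f)) -addrA [ltRHS]splitr.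
  rewrite (le_lt_trans (ler_normD _ _))// ltrD//.
    exact: lt_trans (xP n f fc) nt.
  have -> : f (x n) - f p = f (-1 *: p + x n).
    by rewrite bf_scalar mulN1r addrC.
  by rewrite (le_lt_trans (fc _))// scaleN1r addrC distrC.
(* A general [f] is scaled into the dual ball; adding 1 to its norm avoids a division by 0. *)
move=> f; have N0 : 0 < bf_norm f + 1 by rewrite ltr_wpDl// bf_norm_ge0.
have := Lp ((bf_norm f + 1)^-1 *: f).
rewrite scalarZ -[((_ *: f) : bounded_functional X) p]/(_ * f p) => Lf.
apply: (mulfI (invr_neq0 (lt0r_neq0 N0))); apply: Lf => v.
rewrite [leLHS]normrM normfV (gtr0_norm N0) ler_pdivrMl//.
by rewrite (le_trans (bf_norm_bound rcK f v))// ler_wpM2r// lerDl.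
Qed.

Lemma not_weakly_compact_james (X : completeNormedModType K) (A : set X) (M : K) :
  (forall x, A x -> `|x| <= M) -> ~ relatively_weakly_compact A ->
  exists x f d, [/\ 0 < d, forall n, A (x n) & james_sequence x f d].
Proof.
have HB := hahn_banach_scalars bs.
pose B := bounded_functional X.
move=> AM; rewrite /relatively_weakly_compact compact_ultra.
move=> /existsNP[H /not_implyP[HU /not_implyP[HA Hlim]]].
(* The weak closure is weakly closed and belongs to [H], so a weak limit of [H] anywhere would lie
   in it. *)
have {}Hlim p : ~ (H --> (p : weak X)).
  move=> Hp; apply: Hlim; exists p; split=> //.
  apply: (@closed_cvg _ _ H _ id _ _ _ _ Hp).
  - exact: closed_closure.
  - exact: HA.
have HM : \forall x \near H, `|x| <= M.
  by apply: filterS HA; exact: weak_closure_ball.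
have [||L HL] := @ultralimit_scalar K bs B X H HU (fun f x => f x).
- move=> f; exists (bf_norm f * M); apply: filterS HM => x xM.
  by rewrite (le_trans (bf_norm_bound rcK f x))// ler_wpM2l// bf_norm_ge0.
- move=> a f g; rewrite [X in X @ _](_ : _ = fun=> 0); last first.
    by apply/funext => x; rewrite bf_linearE subrr.
  exact: cvg_cst.
have [d d0 dL] : exists2 d, 0 < d & forall x, exists2 f : B,
    (forall v, `|f v| <= `|v|) & d <= `|L f - f x|.
  apply: contrapT => nod.
  have [e e0|p pL] := @ultralimit_of_contractive_approx X L.
    apply: contrapT => nox; apply: nod; exists e => // x.
    apply: contrapT => nof; apply: nox; exists x => f fc.
    rewrite real_ltNge ?normr_real ?gtr0_real//; apply/negP => ef.
    by apply: nof; exists f.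
  apply: (Hlim p); apply/weak_cvgP => g.
  have [N N0 gN] := dual_bounded g.
  have := HL (bf_of (ltW N0) gN); rewrite pL; exact.
(* [H] lives only on the weak closure of [A], so half of [e] is spent on reaching a point [y] of the
   closure and half on passing from [y] to [A]. *)
have approx (gs : seq B) e : 0 < e ->
    exists2 x, A x & forall g, g \in gs -> `|L g - g x| < e.
  move=> e0; have e20 : 0 < e / 2 by rewrite divr_gt0.
  have Hgs : H [set y | forall g, g \in gs -> `|L g - g y| < e / 2].
    by apply: near_all_seq => g _; exact: scalar_cvg_dist (HL g) e20.
  have [y [/weak_closure_ultra[G [GU GA Gy]] yL]] := filter_ex (filterI HA Hgs).
  have Ggs : G [set x | forall g, g \in gs -> `|(g : B) y - g x| < e / 2].
    apply: near_all_seq => g _.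
    pose g' : dual X := dual_of (bf_norm_bound rcK g : forall v, `|scalar_of (bf_scalar g) v| <= _).
    have : g x @[x --> G] --> g y by exact: (weak_cvgP y).1 Gy g'.
    by move=> /scalar_cvg_dist; apply.
  have [x [Ax yx]] := filter_ex (filterI GA Ggs); exists x => // g ggs.
  rewrite -(subrK (g y) (L g)) -addrA [ltRHS]splitr (le_lt_trans (ler_normD _ _))//.
  by rewrite ltrD ?yL ?yx.
have d20 : 0 < d / 2 by rewrite divr_gt0.
have d40 : 0 < d / 2 / 2 by rewrite divr_gt0.
(* Each new functional comes from Helly's theorem, vanishes at the earlier points and has [L]-value
   at least [d / 2]. The new point then matches [L] within [d / 2 / 2] on all functionals so far,
   which leaves [d / 2 / 2] as lower bound. *)
pose P (s : seq (B * X)) (t : B * X) :=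
    [/\ forall v, `|t.1 v| <= `|v|, forall w, w \in s -> t.1 w.2 = 0,
        d / 2 <= `|L t.1|, A t.2 &
        forall g, g \in t.1 :: map fst s -> `|L g - g t.2| < d / 2 / 2].
have [|u uP] := @prefix_dependent_choice _ P.
  move=> s; have [f [fc fs fd]] := helly rcK HB (map snd s) d0 dL.
  have [x Ax xs] := approx (f :: map fst s) _ d40.
  exists (f, x); split=> // w ws; apply: fs; exact: map_f.
exists (snd \o u), (fun n => scalar_of (bf_scalar (u n).1)), (d / 2 / 2); split=> //.
  by move=> n; have [] := uP n.
split=> [k|j k jk|k j kj] /=.
- by have [] := uP k.
- have [_ + _ _ _] := uP k; apply.
  by apply/mapP; exists j => //; rewrite mem_iota.
- have [_ _ ud _ _] := uP k; have [_ _ _ _ uj] := uP j.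
  have /uj Lk : (u k).1 \in (u j).1 :: map fst (mkseq u j).
    move: kj; rewrite leq_eqVlt inE => /predU1P[->|kj]; first by rewrite eqxx.
    by apply/orP; right; apply/map_f/mapP; exists k => //; rewrite mem_iota.
  rewrite -(lerD2l (d / 2 / 2)) -splitr (le_trans ud)//.
  rewrite -(subrK ((u k).1 (u j).2) (L _)) (le_trans (ler_normD _ _))// lerD//.
  exact: ltW.
Qed.

End eberlein.

(** * Weak compactness of the shifted differences *)

Section shifted_differences.
Variables (K : numFieldType) (X : normedModType K) (y : nat -> X).

(** The value [0] for [k < i] keeps the block of index [k] finite. *)
Definition shifted_difference (i k : nat) : X :=
  if (i <= k)%N then y (k + i).+1 - y k else 0.

Definition shifted_differences : set X :=
  [set shifted_difference ik.1 ik.2 | ik in [set: nat * nat]].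

(** An ultrafilter on the set either contains every tail [D N], and then tends weakly to 0 because
    [y] is weakly Cauchy, or it lives on a finite set. *)
Lemma shifted_differences_weakly_compact :
  weakly_cauchy y -> weakly_compact shifted_differences.
Proof.
move=> yC; rewrite /weakly_compact compact_ultra => G GU GD.
pose D N := [set shifted_difference ik.1 ik.2 | ik in [set ik : nat * nat | (N <= ik.2)%N]].
have [GDN|] := pselect (forall N, G (D N)).
  (* The pair [(1, 0)] has [k < i], so its shifted difference is the default 0. *)
  exists 0; split; first by exists (1, 0)%N.
  apply/weak_cvgP => f; rewrite linear0; apply/(@cvgrPdist_lt K K^o _ G) => e e0.
  have /cvg_ex[l yl] := yC f.
  have e20 : 0 < e / 2 by rewrite divr_gt0.
  have [N _ Nl] : \forall n \near \oo, `|l - sval f (y n)| < e / 2.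
    exact: scalar_cvg_dist yl e20.
  apply: filterS (GDN N) => _ [[i k] /= Nk <-]; rewrite sub0r normrN.
  rewrite /shifted_difference; case: ifP => _; last by rewrite linear0 normr0.
  rewrite linearB/= -(subrK l (sval f (y _))) -addrA [ltRHS]splitr.
  rewrite (le_lt_trans (ler_normD _ _))// ltrD//; last exact: Nl.
  by rewrite distrC; apply: Nl; rewrite /= (leq_trans Nk)// leqW// leq_addr.
move=> /existsNP[N GDN].
(* Below index [N] a value is 0 unless [i <= k], and then both indices are less than [N]. *)
pose E := [set shifted_difference ik.1 ik.2 | ik in `I_N `*` `I_N] `|` [set 0 : X].
have cE : compact (E : set (weak X)).
  apply: finite_compact; rewrite finite_setU; split; last exact: finite_set1.
  by apply: finite_image; apply: finite_setX; exact: finite_II.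
have GE : G E.
  have [//|GD'] := in_ultra_setVsetC (D N) GU.
  apply: filterS (filterI GD GD') => _ [[[i k] _ <-] /= DN].
  have [ik|ik] := leqP i k; last first.
    by right; rewrite /= /shifted_difference leqNgt ik.
  left; exists (i, k) => //; have kN : (k < N)%N.
    by rewrite ltnNge; apply/negP => Nk; apply: DN; exists (i, k).
  by split => //=; exact: leq_ltn_trans kN.
rewrite compact_ultra in cE; have [p [Ep Gp]] := cE G GU GE.
exists p; split=> //; case: Ep => [[ik _ <-]|->]; first by exists ik.
by exists (1, 0)%N.
Qed.

End shifted_differences.

(** * Functionals on the ultrapower *)

Section ultrapower_functional.
Variables (K : numFieldType) (bs : banach_scalars K) (rcK : real_complete K).
Variables (X : normedModType K) (U : set_system nat).
Context {UU : UltraFilter U}.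
Local Notation XU := (@ultrapower K rcK X U _).
Local Notation cls := (@ultrapower_class K rcK X U _).

(** The limit is defined on canonical representatives. Contractive [g k] send null sequences to null
    sequences, so any representative gives the same limit; bounding it by the norm of each
    representative gives contractivity. *)
Lemma ultrapower_functional (g : nat -> {scalar X}) :
  (forall k, contractive (g k)) ->
  exists2 phi : {scalar XU}, contractive phi &
    forall x : linf rcK X, g k (x k) @[k --> U] --> phi (cls x).
Proof.
move=> gc.
have null (x : linf rcK X) : x k @[k --> U] --> (0 : X) ->
    g k (x k) @[k --> U] --> (0 : K).
  move=> /cvgrPdist_lt x0; apply/(@cvgrPdist_lt K K^o _ U) => e /x0.
  apply: filterS => k; rewrite !sub0r !normrN; apply: le_lt_trans; exact: gc.
have [||phi phiP] := @ultralimit_scalar K bs XU nat U UU (fun u k => g k (repr u k)).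
- move=> u; exists `|repr u|; apply: filterE => k.
  by rewrite (le_trans (gc k _))// linf_norm_ge.
- move=> a u v.
  pose x : linf rcK X := repr (a *: u + v) - (a *: repr u + repr v).
  rewrite [X in X @ _](_ : _ = fun k => g k (x k)).
    apply/null/ultrapower_class_eqP.
    by rewrite ultrapower_classD ultrapower_classZ !ultrapower_classK; reflexivity.
  apply/funext => k.
  transitivity (g k (repr (a *: u + v) k - (a *: repr u k + repr v k))) => //.
  by rewrite linearB (linearP (g k)).
have phiE (x : linf rcK X) : g k (x k) @[k --> U] --> phi (cls x).
  rewrite -[phi _]add0r [X in X @ _](_ : _ = fun k =>
    g k ((x - repr (cls x)) k) + g k (repr (cls x) k)); last first.
    apply/funext => k.
    transitivity (g k (x k - repr (cls x) k + repr (cls x) k)); first by rewrite subrK.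
    by rewrite linearD.
  apply: (@cvgD K K^o _ U); last exact: phiP.
  by apply/null/ultrapower_class_eqP; rewrite ultrapower_classK.
exists phi => // u; apply: ultrapower_norm_ge => x <-.
apply: norm_cvg_le (phiE x); apply: filterE => k.
by rewrite (le_trans (gc k _))// linf_norm_ge.
Qed.

End ultrapower_functional.

(** * James sequences in ultrapowers and the equivalence *)

Section property_R_equivalence.
Variables (K : numFieldType) (bs : banach_scalars K) (rcK : real_complete K).

Lemma eventually_ultra_free (U : set_system nat) : \oo `<=` U -> free_filter U.
Proof.
move=> ooU; rewrite /free_filter -subset0 => n nU.
have : [set m | (n < m)%N] n by apply: nU; apply: ooU; exact: nbhs_infty_gt.
by rewrite /= ltnn.
Qed.

Lemma james_not_weakly_compact (X : normedModType K) (A : set X) q phi d :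
  0 < d -> (forall n, A (q n)) -> james_sequence q phi d ->
  ~ relatively_weakly_compact A.
Proof.
move=> d0 Aq [phic phi0 phid]; rewrite /relatively_weakly_compact compact_ultra.
have [U [UU ooU]] := eventually_sub_ultra.
move=> /(_ (q @ U) (fmap_ultra q UU))[|p [_ qp]].
  by apply: (@filterE _ U) => i; apply: subset_closure; exact: Aq.
(* [W] is a subspace containing every [q n], hence norm-dense in its weak closure,
   but [phi j] is small on [W] and large at [p] for large [j]. *)
pose W : set X := [set u | exists m, forall j, (m < j)%N -> phi j u = 0].
have Wlin : linear_set W.
  split; first by exists 0%N => j _; rewrite linear0.
  move=> a u v [m mu] [n nv]; exists (maxn m n) => j.
  by rewrite gtn_max => /andP[mj nj]; rewrite linearP/= mu// nv// mulr0 addr0.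
have Wp : closure (W : set (weak X)) p.
  apply/weak_closure_ultra; exists (q @ U); split=> //; first exact: fmap_ultra.
  by apply: (@filterE _ U) => i; exists i => j; exact: phi0.
have [w [m mw] pw] := weak_closure_linear (hahn_banach_scalars bs) Wlin Wp d0.
have dp : d <= `|phi m.+1 p|.
  apply: (norm_cvg_ge (F := U) (h := fun i => phi m.+1 (q i)) (gtr0_real d0)).
  - by apply: ooU; apply: filterS (nbhs_infty_ge m.+1) => i; exact: phid.
  - exact: (weak_cvgP p).1 qp (dual_contractive (phic m.+1)).
have := le_lt_trans (phic m.+1 (p - w)) pw.
by rewrite linearB/= mw// subr0 => /(le_lt_trans dp); rewrite ltxx.
Qed.

Lemma james_shifted_differences (X : normedModType K) (y : nat -> X)
    (g : nat -> {scalar X}) (d M : K) : 0 < d -> 0 <= M ->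
  (forall n, `|y n| <= M) -> james_sequence y g d ->
  ~ relatively_super_weakly_compact (rcK := rcK) (shifted_differences y).
Proof.
move=> d0 M0 yM [gc g0 gd] rswc.
have [U [UU ooU]] := eventually_sub_ultra.
have Qb i : shifted_difference y i \in @bounded_seq K X.
  apply/bounded_seqP; exists (M + M) => [|k]; first by rewrite addr_ge0.
  rewrite /shifted_difference; case: ifP => _; last by rewrite normr0 addr_ge0.
  by rewrite (le_trans (ler_normB _ _))// lerD.
pose Q i : linf rcK X := @Linf K rcK X _ (Qb i).
(* The shift [(k + j).+1] makes [g] vanish at [y k], so only [y (k + i).+1] counts in [Q i]: it
   gives 0 for [i < j] and modulus at least [d] for [j <= i]. *)
have /choice[phi phiP] : forall j, exists phi : {scalar @ultrapower K rcK X U _},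
    contractive phi /\ forall x : linf rcK X,
    g (k + j).+1 (x k) @[k --> U] --> phi (ultrapower_class _ x).
  move=> j; have [|phi phic phiE] := @ultrapower_functional K bs rcK X U UU
      (fun k => g (k + j).+1); first by move=> k; exact: gc.
  by exists phi.
apply: (james_not_weakly_compact d0 _ _ (rswc U UU (eventually_ultra_free ooU))).
  move=> i; exists (Q i); last reflexivity.
  by move=> k; exists (i, k).
split=> [k|i j ij|j i ji]; first exact: (phiP k).1.
  apply: (scalar_cvg_unique ((phiP j).2 (Q i))).
  rewrite [X in X @ _](_ : _ = fun=> 0); first exact: (@cvg_cst K).
  apply/funext => k; rewrite /= /shifted_difference; case: ifP => _; last by rewrite linear0.
  by rewrite linearB/= !g0 ?subr0// ?ltnS ?leq_addr// ltn_add2l.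
apply: (norm_cvg_ge (gtr0_real d0) _ ((phiP j).2 (Q i))).
(* The finitely many default values of [Q i], at [k < i], are invisible to the free ultrafilter. *)
have /ooU : \oo [set k | (i <= k)%N] by exact: nbhs_infty_ge.
apply: filterS => k /= ik; rewrite /shifted_difference ik linearB/=.
by rewrite (g0 k) ?ltnS ?leq_addr// subr0 gd// ltnS leq_add2l.
Qed.

Lemma relatively_super_weakly_compactS (X : normedModType K) (A B : set X) :
  A `<=` B -> relatively_super_weakly_compact (rcK := rcK) B ->
  relatively_super_weakly_compact (rcK := rcK) A.
Proof.
move=> AB rB U UU freeU; have := rB U UU freeU.
rewrite /relatively_weakly_compact => cB; apply: (subclosed_compact _ cB).
  exact: closed_closure.
by apply: closure_subset => _ [x Ax <-]; exists x => // n; exact/AB/Ax.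
Qed.

Lemma james_subsequence (X : normedModType K) x (f : nat -> {scalar X}) d phi :
  {homo phi : m n / (m < n)%N} -> james_sequence x f d ->
  james_sequence (x \o phi) (f \o phi) d.
Proof.
move=> phi_lt [fc f0 fd]; split=> [k|j k jk|k j kj] /=; first exact: fc.
  exact/f0/phi_lt.
by apply: fd; exact: (ltnW_homo phi_lt).
Qed.

Lemma property_R_equivalence (X : completeNormedModType K) :
  property_R (rcK := rcK) X <->
  (forall A : set X, weakly_compact A -> super_weakly_compact (rcK := rcK) A).
Proof.
have HB := hahn_banach_scalars bs.
split=> [propR A cA|wc A pA].
  split; first exact/propR/weakly_compact_precompact.
  by apply: compact_closed cA; exact: weak_hausdorff.
have [M M0 AM] := weakly_precompact_bounded bs pA.
have [cA|ncA] := pselect (relatively_weakly_compact A).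
  apply: relatively_super_weakly_compactS (wc _ cA).1.
  exact: (@subset_closure (weak X)).
have [x [f [d [d0 Ax xf]]]] := not_weakly_compact_james bs rcK AM ncA.
have [phi phi_lt xC] := pA x Ax.
have := wc _ (shifted_differences_weakly_compact xC).
move=> [/(james_shifted_differences d0 M0 (g := f \o phi)) + _].
case; last exact: james_subsequence.
by move=> n; exact/AM/Ax.
Qed.

End property_R_equivalence.

Theorem corollary2p10 (R : realType) :
  (forall X : completeNormedModType R,
    property_R X <->
    (forall A : set X, weakly_compact A -> super_weakly_compact A)) /\
  (forall X : completeNormedModType (complex R),
    property_R X <->
    (forall A : set X, weakly_compact A -> super_weakly_compact A)).
Proof.
split=> X; apply: property_R_equivalence; first exact: real_banach_scalars.
exact: complex_banach_scalars.
Qed.
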